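(* Let $n\ge3$, $\mathbb{R}^n_+=\{x\in\mathbb{R}^n:x_1>0\}$, and for $1\le j\le n$ let $|\mathbf{X_j}|=(x_1^2+\cdots+x_j^2)^{1/2}$ (so $|\mathbf{X_1}|=x_1$ on $\mathbb{R}^n_+$). Let $1\le k\le n$ and let $\sigma_1,\ldots,\sigma_k$ be real numbers. Set $c_l:=|\sigma_1+\cdots+\sigma_l+l-1|$ for $1\le l\le k$ and assume that $c_l\ne0$ whenever $\sigma_l\ne0$. Then there exists a constant $C>0$ such that for every $w\in C_0^\infty(\mathbb{R}^n_+)$ \[ \int_{\mathbb{R}^n_+}x_1^{\sigma_1}|\mathbf{X_2}|^{\sigma_2}\cdots|\mathbf{X_k}|^{\sigma_k}|\nabla w|\,dx\ \ge\ C\left(\int_{\mathbb{R}^n_+}\left(x_1^{\sigma_1}|\mathbf{X_2}|^{\sigma_2}\cdots|\mathbf{X_k}|^{\sigma_k}|w|\right)^{\frac{n}{n-1}}dx\right)^{\frac{n-1}{n}}, \] and \[ \int_{\mathbb{R}^n_+}x_1^{\frac{\sigma_1(n-2)}{n-1}}|\mathbf{X_2}|^{\frac{\sigma_2(n-2)}{n-1}}\cdots|\mathbf{X_k}|^{\frac{\sigma_k(n-2)}{n-1}}|\nabla w|^2dx\ \ge\ C\left(\int_{\mathbb{R}^n_+}\left(x_1^{\frac{\sigma_1(n-2)}{2(n-1)}}|\mathbf{X_2}|^{\frac{\sigma_2(n-2)}{2(n-1)}}\cdots|\mathbf{X_k}|^{\frac{\sigma_k(n-2)}{2(n-1)}}|w|\right)^{\frac{2n}{n-2}}dx\right)^{\frac{n-2}{n}}.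 \] *)

(* Defs.v *)
From HB Require Import structures.
From mathcomp Require Import all_boot all_order all_algebra.
From mathcomp Require Import all_classical all_reals all_analysis.
Set Implicit Arguments. Unset Strict Implicit. Unset Printing Implicit Defensive.
Import Order.TTheory GRing.Theory Num.Theory.
Import numFieldNormedType.Exports.
Local Open Scope classical_set_scope.
Local Open Scope ring_scope.

(* Points of R^n are row vectors 'rV[R]_n; coordinate x_{i+1} is x 0 i. *)

Definition ebasis {R : realType} {n : nat} (i : 'I_n) : 'rV[R]_n :=
  delta_mx 0 i.

Definition partial {R : realType} {n : nat} (i : 'I_n)
  (f : 'rV[R]_n -> R) : 'rV[R]_n -> R :=
  fun x => 'D_(ebasis i) f x.

Definition iter_partial {R : realType} {n : nat} (s : seq 'I_n)
  (f : 'rV[R]_n -> R) : 'rV[R]_n -> R :=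
  foldr (fun i g => partial i g) f s.

Definition smooth {R : realType} {n : nat} (f : 'rV[R]_n -> R) : Prop :=
  forall s : seq 'I_n,
    continuous (iter_partial s f) /\
    forall (i : 'I_n) (x : 'rV[R]_n), derivable (iter_partial s f) x (ebasis i).

Definition halfspace {R : realType} {n : nat} : set 'rV[R]_n.+1 :=
  [set x | 0 < x 0 ord0].

Definition Cc_infty_half {R : realType} {n : nat} (w : 'rV[R]_n.+1 -> R) : Prop :=
  smooth w /\
  exists K : set 'rV[R]_n.+1,
    compact K /\ K `<=` halfspace /\ (forall x, ~ K x -> w x = 0).

Definition grad_norm {R : realType} {n : nat} (w : 'rV[R]_n -> R)
  (x : 'rV[R]_n) : R :=
  Num.sqrt (\sum_(i < n) (partial i w x) ^+ 2).

Definition normX {R : realType} {n : nat} (j : nat) (x : 'rV[R]_n) : R :=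
  Num.sqrt (\sum_(i < n | (i < j)%N) (x 0 i) ^+ 2).

(* Lebesgue integral over R^n, realised as the iterated one-dimensional
   Lebesgue integral (first coordinate outermost). *)
Fixpoint integral_Rn {R : realType} (n : nat) : ('rV[R]_n -> R) -> R :=
  match n with
  | 0 => fun f => f 0
  | m.+1 => fun f =>
      Rintegral (@lebesgue_measure R) setT
        (fun t : R => integral_Rn (fun y : 'rV[R]_m => f (row_mx (t%:M) y)))
  end.

Definition integral_half {R : realType} {n : nat} (f : 'rV[R]_n.+1 -> R) : R :=
  integral_Rn (fun x => if 0 < x 0 ord0 then f x else 0).

Definition weight {R : realType} {n : nat} (k : nat) (a : nat -> R)
  (x : 'rV[R]_n) : R :=
  \prod_(1 <= j < k.+1) powR (normX j x) (a j).

Definition cconst {R : realType} (sigma : nat -> R) (l : nat) : R :=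
  `| \sum_(1 <= i < l.+1) sigma i + l%:R - 1 |.

(* Main.v *)
(** Write W for the weight x_1^s_1 |X_2|^s_2 ... |X_k|^s_k. The Gagliardo-Nirenberg-Sobolev
    inequality for W w bounds the L^(n/(n-1)) norm of W w by the integral of
    W |grad w| + sum_l |s_l| W |w| / |X_l|, so it suffices to prove the Hardy inequalities
    |s_l| int W |w| / |X_l| <= K int W |grad w|. These come from the divergence of the field
    W X_l / |X_l|, which is (s_1 + ... + s_l + l - 1) W / |X_l| plus terms
    s_j W |X_l| / |X_j|^2 with j > l, dominated by |s_j| W / |X_j|: one argues by downward
    induction on l, the case s_l = 0 being void. The second inequality is the first one for
    |w|^(2(n-1)/(n-2)) combined with the Cauchy-Schwarz inequality. *)

Require Import Defs.
From HB Require Import structures.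
From mathcomp Require Import all_boot all_order all_algebra.
From mathcomp Require Import all_classical all_reals all_analysis.
From mathcomp Require Import lra ring.
Import Order.TTheory GRing.Theory Num.Theory.
Import numFieldNormedType.Exports.
Set Implicit Arguments. Unset Strict Implicit. Unset Printing Implicit Defensive.
Local Open Scope classical_set_scope.
Local Open Scope ring_scope.

(** * Iterated integrals of compactly supported continuous functions *)

(** The obstacle is the integral: linearity of an iterated integral requires every inner integral to
    be an integrable function of the outer variable. All integrands are therefore kept continuous
    with compact support. This costs nothing, since |X_j| vanishes only where x_1 = 0 and [w] is
    zero in a strip around that hyperplane, so [w] times a weight extends by zero to a C^1 function
    on the whole space. Two nonsmooth functions of [w] occur. The Hardy inequality needs a
    nonnegative C^1 function, so |w| is approximated by a C^1 function of [w] that vanishes with it.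
    The second inequality inserts |w|^p with p = 2(n-1)/(n-2), which is C^1 but in general not
    smooth; this is why everything is proved for C^1 functions rather than for smooth ones. *)

Definition cc {R : realType} {n : nat} (f : 'rV[R]_n -> R) : Prop :=
  continuous f /\ exists M : R, forall x : 'rV[R]_n, M < `|x| -> f x = 0.

Lemma rV_norm_le {R : realType} {n : nat} (x : 'rV[R]_n) (M : R) : 0 <= M ->
  (`|x| <= M) <-> (forall i, `|x 0 i| <= M).
Proof.
move=> M0; rewrite /Num.Def.normr /= mx_normrE; split.
  by move=> /bigmax_leP[_ h] i; exact: (h (0, i)).
by move=> h; apply/bigmax_leP; split => // -[i j] _ /=; rewrite ord1; exact: h.
Qed.

Lemma rV_norm_coord {R : realType} {n : nat} (x : 'rV[R]_n) i :
  `|x 0 i| <= `|x|.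
Proof. by move: i; apply/rV_norm_le. Qed.

Lemma row_mx_ord0 {R : realType} {n : nat} (t : R) (y : 'rV[R]_n) :
  (row_mx t%:M y : 'rV[R]_n.+1) 0 ord0 = t.
Proof.
rewrite (_ : ord0 = lshift n (ord0 : 'I_1)); last exact: val_inj.
by rewrite (row_mxEl (t%:M : 'M[R]_1) y) mxE eqxx mulr1n.
Qed.

Lemma row_mx_lift {R : realType} {n : nat} (t : R) (y : 'rV[R]_n) (i : 'I_n) :
  (row_mx t%:M y : 'rV[R]_n.+1) 0 (lift ord0 i) = y 0 i.
Proof.
rewrite (_ : lift ord0 i = rshift 1 i); last exact: val_inj.
by rewrite (row_mxEr (t%:M : 'M[R]_1) y).
Qed.

Lemma row_mx_norm_le {R : realType} {n : nat} (t M : R) (y : 'rV[R]_n) :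
  `|row_mx t%:M y : 'rV[R]_n.+1| <= M <-> `|t| <= M /\ `|y| <= M.
Proof.
have [M0|M0] := leP 0 M; last first.
  by split=> [h|[h _]]; move: (normr_ge0 t) (normr_ge0 (row_mx t%:M y : 'rV[R]_n.+1)); lra.
rewrite !rV_norm_le//; split.
  move=> h; split; first by rewrite -(row_mx_ord0 t y); exact: h.
  by move=> i; rewrite -(row_mx_lift t y); exact: h.
move=> [ht hy] i; case: (unliftP ord0 i) => [j|] ->.
  by rewrite row_mx_lift.
by rewrite row_mx_ord0.
Qed.

Lemma row_mx_norml {R : realType} {n : nat} (t : R) (y : 'rV[R]_n) :
  `|t| <= `|row_mx t%:M y : 'rV[R]_n.+1|.
Proof. by have [+ _] := row_mx_norm_le t `|row_mx t%:M y : 'rV[R]_n.+1| y => /(_ (lexx _))[]. Qed.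

Lemma row_mx_normr {R : realType} {n : nat} (t : R) (y : 'rV[R]_n) :
  `|y| <= `|row_mx t%:M y : 'rV[R]_n.+1|.
Proof. by have [+ _] := row_mx_norm_le t `|row_mx t%:M y : 'rV[R]_n.+1| y => /(_ (lexx _))[]. Qed.

Lemma row_mxB {R : realType} {n : nat} (s t : R) (y z : 'rV[R]_n) :
  (row_mx s%:M y : 'rV[R]_n.+1) - row_mx t%:M z = row_mx (s - t)%:M (y - z).
Proof.
apply/rowP => i; rewrite [LHS]mxE [X in _ + X]mxE.
by case: (unliftP ord0 i) => [j|] ->; rewrite ?row_mx_lift ?row_mx_ord0 // !mxE.
Qed.

Lemma continuous_epsP {R : realType} {n : nat} (f : 'rV[R]_n -> R) (x : 'rV[R]_n) :
  {for x, continuous f} <->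
  forall e : R, 0 < e -> exists2 d : R, 0 < d &
    forall y : 'rV[R]_n, `|x - y| < d -> `|f x - f y| < e.
Proof.
split=> [cf e e0|h].
  have /cvgrPdist_lt /(_ _ e0) /nbhs_ballP[d /= d0 hd] := cf.
  by exists d => // y hy; apply: hd; rewrite -ball_normE.
apply/(@cvgrPdist_lt _ _ _ (nbhs x)) => e /h[d d0 hd].
by apply/nbhs_ballP; exists d => // y; rewrite -ball_normE /=; exact: hd.
Qed.

Lemma cc_supp {R : realType} {n : nat} (f : 'rV[R]_n -> R) : cc f ->
  exists2 M : R, 0 <= M & forall x : 'rV[R]_n, M < `|x| -> f x = 0.
Proof.
move=> [_ [M hM]]; exists `|M| => // x hx; apply: hM.
exact: le_lt_trans (ler_norm _) hx.
Qed.

(** Heine-Cantor on the cube of radius [M + 1]; beyond it both values vanish as soon as the two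
    points are less than 1 apart. *)
Lemma cc_unif {R : realType} {n : nat} (f : 'rV[R]_n -> R) : cc f ->
  forall e : R, 0 < e -> exists2 d : R, 0 < d & forall x y : 'rV[R]_n, `|x - y| < d -> `|f x - f y| < e.
Proof.
move=> ccf e e0; have [M M0 hM] := cc_supp ccf; case: ccf => cf _.
pose K := [set v : 'rV[R]_n | forall i, `[(- (M + 1)), (M + 1)]%classic (v ord0 i)].
have cK : compact K.
  by apply: (@rV_compact _ _ (fun=> `[(- (M + 1)), (M + 1)]%classic)) => _; exact: segment_compact.
(* Compactness in covering form: if every small [d] is a modulus near each point of [K], then a
   single [d] serves all of [K]. *)
move/compact_near_coveringP : cK.
move=> /(_ R (0^'+) (fun (d : R) (x : 'rV[R]_n) => forall y : 'rV[R]_n, `|x - y| < d -> `|f x - f y| < e)).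
have : forall x, K x -> \forall x' \near x & d \near 0^'+,
    forall y : 'rV[R]_n, `|x' - y| < d -> `|f x' - f y| < e.
  move=> x _; have /continuous_epsP/(_ _ (divr_gt0 e0 (ltr0n R 2)))[d d0 hd] := cf x.
  exists (ball x (d / 2), [set t | 0 < t < d / 2]) => /=.
    split; first by apply: nbhsx_ballx; rewrite divr_gt0.
    by near=> t; apply/andP; split => //; near: t; apply: nbhs_right_lt; rewrite divr_gt0.
  move=> [x' t]/= []; rewrite -ball_normE /= => hx' /andP[t0 ht] y hy.
  have h1 : `|f x - f x'| < e / 2 by apply: hd; lra.
  have h2 : `|f x - f y| < e / 2.
    apply: hd; rewrite (_ : x - y = (x - x') + (x' - y)); last by rewrite subrKA.
    by apply: le_lt_trans (ler_normD _ _) _; lra.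
  rewrite (_ : f x' - f y = (f x - f y) - (f x - f x')); last by ring.
  by apply: le_lt_trans (ler_normB _ _) _; lra.
move=> h /(_ _ h) hnear.
have [d [d0 hd]] : exists d : R, 0 < d /\ forall x : 'rV[R]_n, K x ->
    forall y : 'rV[R]_n, `|x - y| < d -> `|f x - f y| < e.
  have : \forall d \near 0^'+, 0 < d /\ forall x : 'rV[R]_n, K x ->
      forall y : 'rV[R]_n, `|x - y| < d -> `|f x - f y| < e.
    by near=> d; split => //; near: d.
  by move=> /filter_ex[d hd]; exists d.
exists (Num.min d 1); first by rewrite lt_min d0 ltr01.
move=> x y; rewrite lt_min => /andP[xyd xy1].
have [xM|xM] := leP `|x| (M + 1).
  by apply: hd => // i /=; rewrite in_itv /= -ler_norml; exact: le_trans (rV_norm_coord _ _) xM.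
have hx : M < `|x| by apply: lt_trans xM; rewrite ltrDl.
have hy : M < `|y| by move: (lerB_dist x y); lra.
by rewrite !hM// subrr normr0.
Unshelve. all: by end_near.
Qed.

Definition slice {R : realType} {n : nat} (t : R) (f : 'rV[R]_n.+1 -> R) : 'rV[R]_n -> R :=
  fun y => f (row_mx t%:M y).

Lemma cc_slice {R : realType} {n : nat} (t : R) (f : 'rV[R]_n.+1 -> R) :
  cc f -> cc (slice t f).
Proof.
move=> ccf; split; last first.
  have [M M0 hM] := cc_supp ccf; exists M => y hy; apply: hM.
  exact: lt_le_trans hy (row_mx_normr _ _).
move=> y; apply/continuous_epsP => e e0.
have [d d0 hd] := cc_unif ccf e0.
exists d => // z yz; apply: hd; rewrite row_mxB subrr.
apply: le_lt_trans yz.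
by apply/row_mx_norm_le; split => //; rewrite normr0.
Qed.

Definition cc1 {R : realType} (g : R -> R) : Prop :=
  continuous g /\ exists2 M : R, 0 <= M & forall t, M < `|t| -> g t = 0.

Lemma restrict_supp {R : realType} (g : R -> R) (a b M : R) :
  a <= - M -> M <= b -> (forall t, M < `|t| -> g t = 0) -> g \_ `[a, b] = g.
Proof.
move=> aM Mb hM; apply/funext => t; rewrite patchE; case: ifPn => //.
move=> /negP; rewrite inE /= in_itv /= => /negP h; rewrite hM// ltNge ler_norml.
apply: contra h => /andP[h1 h2]; apply/andP; split; lra.
Qed.

Lemma cc1_integrable_itv {R : realType} (g : R -> R) (a b : R) :
  continuous g -> (@lebesgue_measure R).-integrable `[a, b] (EFin \o g).
Proof.
move=> cg; apply: continuous_compact_integrable; first exact: segment_compact.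
exact: continuous_subspaceT.
Qed.

Lemma cc1_integrable {R : realType} (g : R -> R) :
  cc1 g -> (@lebesgue_measure R).-integrable setT (EFin \o g).
Proof.
move=> [cg [M M0 hM]].
have := cc1_integrable_itv (- M) M cg.
rewrite integrable_mkcond//.
by rewrite restrict_EFin (restrict_supp (lexx _) (lexx _) hM).
Qed.

Lemma Rintegral_supp {R : realType} (g : R -> R) (a b M : R) :
  a <= - M -> M <= b -> (forall t, M < `|t| -> g t = 0) ->
  \int[@lebesgue_measure R]_t g t = \int[@lebesgue_measure R]_(t in `[a, b]) g t.
Proof.
move=> aM Mb hM; rewrite [RHS]Rintegral_mkcond; apply: eq_Rintegral => t _.
by rewrite -[in LHS](restrict_supp aM Mb hM).
Qed.

Lemma Rintegral_cst_itv {R : realType} (c a b : R) : a <= b ->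
  \int[@lebesgue_measure R]_(t in `[a, b]) c = c * (b - a).
Proof.
move=> ab; rewrite Rintegral_cst//= lebesgue_measure_itv/= lte_fin.
by case: ltgtP ab => //= -> _; rewrite subrr.
Qed.

Lemma Rintegral_bound {R : realType} (g : R -> R) (c M : R) : cc1 g -> 0 <= M ->
  (forall t, M < `|t| -> g t = 0) -> (forall t, `|g t| <= c) ->
  `| \int[@lebesgue_measure R]_t g t | <= c * (2 * M).
Proof.
move=> [cg _] M0 hM hc; rewrite (Rintegral_supp (lexx _) (lexx _) hM).
apply: le_trans (le_normr_Rintegral _ _) _ => //; first exact: cc1_integrable_itv.
have -> : c * (2 * M) = \int[@lebesgue_measure R]_(t in `[- M, M]) c.
  by rewrite Rintegral_cst_itv; [congr (_ * _); ring|lra].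
apply: le_Rintegral => //; last first.
- by apply: (@cc1_integrable_itv _ (cst c)); exact: cst_continuous.
- apply: (@cc1_integrable_itv _ (fun t => `|g t|)) => t.
  by apply: continuous_comp; [exact: cg|exact: norm_continuous].
Qed.

Lemma ccD {R : realType} {n : nat} (f g : 'rV[R]_n -> R) :
  cc f -> cc g -> cc (fun x => f x + g x).
Proof.
move=> cf cg; split; first by move=> x; apply: continuousD; [exact: cf.1|exact: cg.1].
have [M _ hM] := cc_supp cf; have [N _ hN] := cc_supp cg.
exists (Num.max M N) => x; rewrite gt_max => /andP[h1 h2].
by rewrite hM// hN// addr0.
Qed.

Lemma ccMr {R : realType} {n : nat} (f g : 'rV[R]_n -> R) :
  continuous f -> cc g -> cc (fun x => f x * g x).
Proof.
move=> cf cg; split; first by move=> x; apply: continuousM; [exact: cf|exact: cg.1].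
by have [M _ hM] := cc_supp cg; exists M => x h; rewrite hM// mulr0.
Qed.

Lemma ccZ {R : realType} {n : nat} (c : R) (g : 'rV[R]_n -> R) :
  cc g -> cc (fun x => c * g x).
Proof. by apply: ccMr => x; exact: cst_continuous. Qed.

Lemma ccN {R : realType} {n : nat} (g : 'rV[R]_n -> R) :
  cc g -> cc (fun x => - g x).
Proof. by move=> /(ccZ (-1)); congr cc; apply/funext => x; rewrite mulN1r. Qed.

Lemma ccB {R : realType} {n : nat} (f g : 'rV[R]_n -> R) :
  cc f -> cc g -> cc (fun x => f x - g x).
Proof. by move=> cf cg; apply: ccD => //; exact: ccN. Qed.

Lemma cc_comp {R : realType} {n : nat} (th : R -> R) (g : 'rV[R]_n -> R) :
  continuous th -> th 0 = 0 -> cc g -> cc (fun x => th (g x)).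
Proof.
move=> cth th0 cg; split.
  by move=> x; apply: continuous_comp; [exact: cg.1|exact: cth].
by have [M _ hM] := cc_supp cg; exists M => x h; rewrite hM.
Qed.

Lemma cc_norm {R : realType} {n : nat} (g : 'rV[R]_n -> R) :
  cc g -> cc (fun x => `|g x|).
Proof. by apply: cc_comp; [exact: norm_continuous|exact: normr0]. Qed.

Lemma cc_sum {R : realType} {n : nat} {I : Type} (r : seq I) (P : pred I)
  (F : I -> 'rV[R]_n -> R) :
  (forall i, P i -> cc (F i)) -> cc (fun x => \sum_(i <- r | P i) F i x).
Proof.
move=> h; elim: r => [|i r IH].
  under eq_fun do rewrite big_nil.
  by split; [move=> x; exact: cst_continuous|exists 0].
under eq_fun do rewrite big_cons.
by case Pi: (P i); [exact: (ccD (h i Pi) IH)|exact: IH].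
Qed.

(* One induction on the dimension has to prove the four properties together:
   the bound in dimension [n] makes [t |-> integral of the slice at t]
   continuous, hence integrable, which linearity in dimension [n.+1] needs. *)
Definition integral_linear_on_cc {R : realType} (n : nat) : Prop :=
  [/\ forall f g : 'rV[R]_n -> R, cc f -> cc g ->
      integral_Rn (fun x => f x + g x) = integral_Rn f + integral_Rn g,
    forall (c : R) (f : 'rV[R]_n -> R), cc f ->
      integral_Rn (fun x => c * f x) = c * integral_Rn f,
    forall f g : 'rV[R]_n -> R, cc f -> cc g -> (forall x, f x <= g x) ->
      integral_Rn f <= integral_Rn g &
    forall (f : 'rV[R]_n -> R) (c M : R), cc f -> 0 <= M -> 
      (forall x : 'rV[R]_n, M < `|x| -> f x = 0) -> (forall x, `|f x| <= c) ->
      `|integral_Rn f| <= c * (2 * M) ^+ n].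

(** Slices at nearby parameters are uniformly close, and their difference lives in the cube of side
    [2 * M], so the integrals differ by at most that closeness times the volume. *)
Lemma cc1_slice_of {R : realType} {n : nat} (f : 'rV[R]_n.+1 -> R) :
  @integral_linear_on_cc R n -> cc f -> cc1 (fun t => integral_Rn (slice t f)).
Proof.
move=> [hD hZ _ hB] ccf.
have [M M0 hM] := cc_supp ccf.
split; last first.
  exists M => // t Mt.
  have h : forall y, slice t f y = 0.
    by move=> y; apply: hM; apply: lt_le_trans Mt (row_mx_norml _ _).
  (* The bound with constant 0 says that a slice off the support has integral 0. *)
  have := hB _ 0 0 (cc_slice t ccf) (lexx _) (fun x _ => h x).
  rewrite mul0r => /(_ _)/wrap[y|]; first by rewrite h normr0.
  by move=> h0; apply/eqP; rewrite -normr_le0.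
move=> t; apply/(@cvgrPdist_lt _ _ _ (nbhs t)) => e e0.
(* The added 1 keeps the divisor positive when [M = 0] and makes the final estimate strict. *)
have C0 : 0 < (2 * M) ^+ n + 1 by rewrite ltr_pwDr// exprn_ge0// mulr_ge0.
have [d d0 hd] := cc_unif ccf (divr_gt0 e0 C0).
apply/nbhs_ballP; exists d => // s; rewrite -ball_normE /= => ts.
have sub : integral_Rn (slice t f) - integral_Rn (slice s f) =
    integral_Rn (fun y => slice t f y - slice s f y).
  rewrite (hD _ (fun y => - slice s f y)); [|exact: cc_slice|exact/ccN/cc_slice].
  congr (_ + _); rewrite -mulN1r -hZ; last exact: cc_slice.
  by congr integral_Rn; apply/funext => y; rewrite mulN1r.
rewrite sub.
apply: le_lt_trans (hB _ (e / ((2 * M) ^+ n + 1)) M _ _ _ _) _ => //.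
- by apply: ccB; exact: cc_slice.
- move=> y My; rewrite /slice !hM ?subrr//; exact: lt_le_trans My (row_mx_normr _ _).
- move=> y; apply/ltW; apply: hd; rewrite row_mxB subrr.
  by apply: le_lt_trans ts; apply/row_mx_norm_le; split => //; rewrite normr0.
- rewrite mulrAC ltr_pdivrMr// ltr_pM2l// ltrDl ltr01 //.
Qed.

Lemma integral_Rn_linear {R : realType} (n : nat) : @integral_linear_on_cc R n.
Proof.
elim: n => [|n IH].
  split=> //=; by move=> f c M _ _ _ hc; rewrite expr0 mulr1.
have I1 := fun f (h : cc f) => cc1_integrable (cc1_slice_of IH h).
have [hD hZ hL hB] := IH.
split.
- move=> f g cf cg /=.
  rewrite -RintegralD//; [|exact: I1|exact: I1].
  by apply: eq_Rintegral => t _; rewrite -hD//; exact: cc_slice.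
- move=> c f cf /=.
  rewrite -RintegralZl//; last exact: I1.
  by apply: eq_Rintegral => t _; rewrite -hZ//; exact: cc_slice.
- move=> f g cf cg fg /=; apply: le_Rintegral => //; [exact: I1|exact: I1|].
  by move=> t _; apply: hL; [exact: cc_slice|exact: cc_slice|move=> y; exact: fg].
- move=> f c M cf M0 hM hc /=.
  rewrite exprSr mulrA; apply: Rintegral_bound => //.
  + exact: (cc1_slice_of IH cf).
  + move=> t Mt; apply/eqP; rewrite -normr_le0.
    have := hB (slice t f) 0 M (cc_slice t cf) M0.
    rewrite mul0r; apply.
      by move=> y My; apply: hM; exact: lt_le_trans My (row_mx_normr _ _).
    by move=> y; rewrite /slice hM ?normr0//; exact: lt_le_trans Mt (row_mx_norml _ _).
  + move=> t; apply: (hB (slice t f)) => //; first exact: cc_slice.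
    by move=> y My; apply: hM; exact: lt_le_trans My (row_mx_normr _ _).
  by move=> y; exact: hc.
Qed.
Section integral_Rn_theory.
Context {R : realType} {n : nat}.
Implicit Types f g : 'rV[R]_n -> R.

Lemma integral_RnD f g : cc f -> cc g ->
  integral_Rn (fun x => f x + g x) = integral_Rn f + integral_Rn g.
Proof. by have [h _ _ _] := @integral_Rn_linear R n; exact: h. Qed.

Lemma integral_RnZ c f : cc f -> integral_Rn (fun x => c * f x) = c * integral_Rn f.
Proof. by have [_ h _ _] := @integral_Rn_linear R n; exact: h. Qed.

Lemma le_integral_Rn f g : cc f -> cc g -> (forall x, f x <= g x) ->
  integral_Rn f <= integral_Rn g.
Proof. by have [_ _ h _] := @integral_Rn_linear R n; exact: h. Qed.

Lemma integral_Rn_bound f c M : cc f -> 0 <= M ->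
  (forall x : 'rV[R]_n, M < `|x| -> f x = 0) -> (forall x, `|f x| <= c) ->
  `|integral_Rn f| <= c * (2 * M) ^+ n.
Proof. by have [_ _ _ h] := @integral_Rn_linear R n; exact: h. Qed.

Lemma integral_RnN f : cc f -> integral_Rn (fun x => - f x) = - integral_Rn f.
Proof.
move=> cf; rewrite -mulN1r -integral_RnZ//; congr integral_Rn.
by apply/funext => x; rewrite mulN1r.
Qed.

Lemma integral_RnB f g : cc f -> cc g ->
  integral_Rn (fun x => f x - g x) = integral_Rn f - integral_Rn g.
Proof. by move=> cf cg; rewrite integral_RnD ?integral_RnN//; exact: ccN. Qed.

Lemma integral_Rn0 : integral_Rn (fun _ : 'rV[R]_n => 0) = 0.
Proof.
have c0 : cc (fun _ : 'rV[R]_n => 0 : R) by split; [move=> x; exact: cst_continuous|exists 0].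
by have := integral_RnZ 0 c0; rewrite !mul0r.
Qed.

Lemma integral_Rn_ge0 f : cc f -> (forall x, 0 <= f x) -> 0 <= integral_Rn f.
Proof.
move=> cf f0; rewrite -integral_Rn0; apply: le_integral_Rn => //.
by split; [move=> x; exact: cst_continuous|exists 0].
Qed.

Lemma integral_Rn_sum {I : Type} (r : seq I) (P : pred I) (F : I -> 'rV[R]_n -> R) :
  (forall i, P i -> cc (F i)) ->
  integral_Rn (fun x => \sum_(i <- r | P i) F i x) = \sum_(i <- r | P i) integral_Rn (F i).
Proof.
move=> h; elim: r => [|i r IH].
  by rewrite big_nil; under eq_fun do rewrite big_nil; exact: integral_Rn0.
under eq_fun do rewrite big_cons; rewrite big_cons.
case Pi: (P i); last exact: IH.
by rewrite (integral_RnD (h i Pi) (cc_sum _ h)) IH.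
Qed.

Lemma le_norm_integral_Rn f : cc f -> `|integral_Rn f| <= integral_Rn (fun x => `|f x|).
Proof.
move=> cf; rewrite ler_norml -integral_RnN; last exact: cc_norm.
apply/andP; split; apply: le_integral_Rn => //; try exact: cc_norm.
- by apply: ccN; exact: cc_norm.
- by move=> x; rewrite lerNl -normrN; exact: ler_norm.
- by move=> x; exact: ler_norm.
Qed.
End integral_Rn_theory.

Lemma cc1_slice {R : realType} {n : nat} (f : 'rV[R]_n.+1 -> R) :
  cc f -> cc1 (fun t => integral_Rn (slice t f)).
Proof. exact/cc1_slice_of/integral_Rn_linear. Qed.

(** * A comparison theorem in one variable *)

Lemma cc1_unif {R : realType} (g : R -> R) : cc1 g ->
  forall e : R, 0 < e -> exists2 d : R, 0 < d & forall s t, `|s - t| < d -> `|g s - g t| < e.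
Proof.
move=> [cg [M M0 hM]] e e0.
have ccG : cc (fun x : 'rV[R]_1 => g (x 0 0)).
  split; first by move=> x; apply: continuous_comp; [exact: coord_continuous|exact: cg].
  exists M => x Mx; apply: hM; rewrite ltNge; apply: contraTN Mx => hx; rewrite -leNgt.
  by apply/rV_norm_le => // i; rewrite ord1.
have [d d0 hd] := cc_unif ccG e0.
exists d => // s t st; have := hd (const_mx s) (const_mx t); rewrite !mxE; apply.
apply: le_lt_trans st; apply/rV_norm_le => // i; by rewrite !mxE.
Qed.

Lemma Rintegral_itv_split {R : realType} (g : R -> R) (a b c : R) :
  continuous g -> a <= b -> b <= c ->
  \int[@lebesgue_measure R]_(t in `[a, c]) g t =
  \int[@lebesgue_measure R]_(t in `[a, b]) g t + \int[@lebesgue_measure R]_(t in `[b, c]) g t.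
Proof.
move=> cg ab bc.
have := @Rintegral_itvB R g (BLeft a) (BRight c) b (cc1_integrable_itv _ _ cg).
rewrite !bnd_simp => /(_ ab bc).
rewrite Rintegral_itv_obnd_cbnd; first by move=> <-; rewrite addrC subrK.
by apply: integrableS (cc1_integrable_itv b c cg) => //; apply: subset_itvr; rewrite bnd_simp.
Qed.

(* A one-sided comparison theorem: [phi] need not be differentiable, a uniform
   upper bound on its forward difference quotients suffices. *)
Lemma increment_le_Rintegral {R : realType} (phi psi : R -> R) (a b : R) :
  cc1 psi -> a <= b ->
  (forall e : R, 0 < e -> exists2 d : R, 0 < d &
     forall t h, 0 < h < d -> phi (h + t) - phi t <= h * (psi t + e)) ->
  phi b - phi a <= \int[@lebesgue_measure R]_(t in `[a, b]) psi t.
Proof.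
move=> cpsi ab hphi; have [cps _] := cpsi.
apply/ler_addgt0Pr => e0 e0_gt0.
have ba1 : 0 < 2 * (b - a + 1) by lra.
(* A step of length [h] costs [2 * e * h]: one [e] from the difference quotient, one from the
   oscillation of [psi]. The total 2e(b - a) stays below [e0], and the added 1 allows a = b. *)
pose e := e0 / (2 * (b - a + 1)).
have e_gt0 : 0 < e by rewrite divr_gt0.
have [d1 d1_gt0 h1] := hphi e e_gt0.
have [d2 d2_gt0 h2] := cc1_unif cpsi e_gt0.
have step t h : 0 < h -> h < d1 -> h < d2 ->
    phi (h + t) - phi t <= \int[@lebesgue_measure R]_(t in `[t, h + t]) psi t + 2 * e * h.
  move=> h0 hd1 hd2.
  have := h1 t h; rewrite h0 hd1 => /(_ isT) hle.
  have : \int[@lebesgue_measure R]_(s in `[t, h + t]) (psi t - e) <=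
         \int[@lebesgue_measure R]_(s in `[t, h + t]) psi s.
    apply: le_Rintegral => //.
    - by apply: (@cc1_integrable_itv _ (cst (psi t - e))); exact: cst_continuous.
    - exact: cc1_integrable_itv.
    move=> s /=; rewrite in_itv /= => /andP[ts sh].
    have : `|t - s| < d2 by rewrite ltr_norml; apply/andP; split; lra.
    by move=> /h2; rewrite ltr_norml => /andP[]; lra.
  rewrite Rintegral_cst_itv; last lra.
  have -> : h + t - t = h by ring.
  by move: hle; nra.
have induct N h : 0 < h -> h < d1 -> h < d2 ->
    phi (N%:R * h + a) - phi a <=
    \int[@lebesgue_measure R]_(t in `[a, N%:R * h + a]) psi t + 2 * e * (N%:R * h).
  move=> h0 hd1 hd2; elim: N => [|N IH].
    by rewrite mul0r add0r subrr mulr0 addr0 set_itv1 Rintegral_set1.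
  have -> : N.+1%:R * h + a = h + (N%:R * h + a) by rewrite -natr1; ring.
  have Nh : 0 <= N%:R * h by rewrite mulr_ge0// ltW.
  rewrite (@Rintegral_itv_split _ _ a (N%:R * h + a)) //; [|lra|lra].
  have := step (N%:R * h + a) h h0 hd1 hd2.
  rewrite -natr1; move: IH; set I1 := Rintegral _ _ _; set I2 := Rintegral _ _ _.
  by move=> i1 i2; nra.
have [ba|ba] := eqVneq a b.
  by rewrite ba subrr set_itv1 Rintegral_set1 add0r ltW.
have ab' : 0 < b - a by rewrite subr_gt0 lt_neqAle ba.
have [N hN] : exists N : nat, (b - a) / Num.min d1 d2 < N.+1%:R.
  exists (Num.truncn ((b - a) / Num.min d1 d2)); exact: truncnS_gt.
have m0 : 0 < Num.min d1 d2 by rewrite lt_min d1_gt0.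
have hlt : (b - a) / N.+1%:R < Num.min d1 d2.
  by rewrite ltr_pdivrMr// mulrC -ltr_pdivrMr.
move: hlt; rewrite lt_min => /andP[hd1 hd2].
have := induct N.+1 ((b - a) / N.+1%:R) (divr_gt0 ab' (ltr0Sn _ _)) hd1 hd2.
have -> : N.+1%:R * ((b - a) / N.+1%:R) = b - a by rewrite mulrC divfK// pnatr_eq0.
rewrite subrK => /le_trans; apply; rewrite lerD2l.
have : e * (2 * (b - a + 1)) = e0 by rewrite /e divfK// gt_eqF.
by move: e_gt0; nra.
Qed.
(** * Partial derivatives under the integral *)

Lemma ebasis_norm_le {R : realType} {n : nat} (i : 'I_n) : `|ebasis i : 'rV[R]_n| <= 1.
Proof.
apply/rV_norm_le => // j; rewrite mxE.
by case: (_ && _); rewrite ?normr1 ?normr0.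
Qed.

Lemma ebasis_neq0 {R : realType} {n : nat} (i : 'I_n) : (ebasis i : 'rV[R]_n) != 0.
Proof.
by apply/eqP => /rowP /(_ i) /eqP; rewrite !mxE !eqxx /= oner_eq0.
Qed.

Definition c1c {R : realType} {n : nat} (f : 'rV[R]_n -> R) : Prop :=
  [/\ cc f, forall i x, derivable f x (ebasis i) & forall i, continuous (partial i f)].

Lemma near_eq_partial {R : realType} {n : nat} (i : 'I_n) (f g : 'rV[R]_n -> R) x :
  {near x, f =1 g} -> partial i f x = partial i g x.
Proof. by move=> fg; apply: near_eq_derive => //; exact: ebasis_neq0. Qed.

Lemma partial_cst {R : realType} {n : nat} (i : 'I_n) (c : R) (x : 'rV[R]_n) :
  partial i (cst c) x = 0.
Proof. exact: derive_val. Qed.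

Lemma near_norm_gt {R : realType} {n : nat} (x : 'rV[R]_n) (M : R) :
  M < `|x| -> \forall y \near x, M < `|y|.
Proof.
move=> Mx; have d0 : 0 < `|x| - M by rewrite subr_gt0.
apply/nbhs_ballP; exists (`|x| - M) => // y; rewrite -ball_normE /=.
by move: (lerB_dist x y); lra.
Qed.

Lemma cc_partial {R : realType} {n : nat} (f : 'rV[R]_n -> R) i : c1c f -> cc (partial i f).
Proof.
move=> [cf _ cp]; split; first exact: cp.
have [M M0 hM] := cc_supp cf; exists M => x Mx.
rewrite -(partial_cst i 0 x); apply: near_eq_partial.
by have := near_norm_gt Mx; apply: filterS => y; exact: hM.
Qed.

(** This turns a directional derivative into the derivative of a function of one real variable, to
    which the mean value theorem and the one-variable chain rule apply. *)
Lemma is_derive_line {R : realType} {V : normedModType R} (f : V -> R) (x v : V) (s : R) :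
  derivable f (s *: v + x) v ->
  is_derive s 1 (fun s => f (s *: v + x)) ('D_v f (s *: v + x)).
Proof.
have e : (fun h : R => h^-1 *: (f (h *: v + (s *: v + x)) - f (s *: v + x))) =
    (fun h : R => h^-1 *: (f ((h *: 1 + s) *: v + x) - f (s *: v + x))).
  by apply/funext => h; rewrite scalerDl addrA [h *: 1]mulr1.
move=> df; apply: DeriveDef; first by rewrite /derivable -e.
by rewrite /derive -e.
Qed.

Lemma row_mx_shift_lift {R : realType} {n : nat} (t h : R) (y : 'rV[R]_n) (j : 'I_n) :
  (row_mx t%:M (h *: ebasis j + y) : 'rV[R]_n.+1) =
  h *: ebasis (lift ord0 j) + row_mx t%:M y.
Proof.
apply/rowP => i; rewrite [RHS]mxE.
case: (unliftP ord0 i) => [k|] ->.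
  by rewrite !row_mx_lift !mxE /= (inj_eq lift_inj).
by rewrite !row_mx_ord0 !mxE /= mulr0 add0r.
Qed.

Lemma row_mx_shift0 {R : realType} {n : nat} (t h : R) (y : 'rV[R]_n) :
  (row_mx (h + t)%:M y : 'rV[R]_n.+1) = h *: ebasis ord0 + row_mx t%:M y.
Proof.
apply/rowP => i; rewrite [RHS]mxE.
case: (unliftP ord0 i) => [k|] ->.
  by rewrite !row_mx_lift !mxE /= mulr0 add0r.
by rewrite !row_mx_ord0 !mxE /= mulr1.
Qed.

Lemma slice_quotient {R : realType} {n : nat} (f : 'rV[R]_n.+1 -> R) t (y : 'rV[R]_n) j :
  (fun h : R => h^-1 *: (slice t f (h *: ebasis j + y) - slice t f y)) =
  (fun h : R => h^-1 *: (f (h *: ebasis (lift ord0 j) + row_mx t%:M y) - f (row_mx t%:M y))).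
Proof. by apply/funext => h; rewrite /slice row_mx_shift_lift. Qed.

Lemma derivable_slice {R : realType} {n : nat} (f : 'rV[R]_n.+1 -> R) t (y : 'rV[R]_n) j :
  derivable f (row_mx t%:M y) (ebasis (lift ord0 j)) -> derivable (slice t f) y (ebasis j).
Proof. by move=> h; rewrite /derivable slice_quotient. Qed.

Lemma partial_slice {R : realType} {n : nat} (f : 'rV[R]_n.+1 -> R) t j :
  partial j (slice t f) = slice t (partial (lift ord0 j) f).
Proof.
apply/funext => y; rewrite /partial /derive slice_quotient.
by rewrite /slice /partial /derive.
Qed.

Lemma c1c_slice {R : realType} {n : nat} (f : 'rV[R]_n.+1 -> R) t :
  c1c f -> c1c (slice t f).
Proof.
move=> cf; have [ccf df cp] := cf; split; first exact: cc_slice.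
  by move=> j y; apply: derivable_slice; exact: df.
by move=> j; rewrite partial_slice; exact: (cc_slice t (cc_partial _ cf)).1.
Qed.

(** The mean value theorem replaces the increment by [h] times the partial derivative at an
    intermediate point; uniform continuity of that derivative makes [d] independent of [x]. *)
Lemma partial_increment {R : realType} {n : nat} (f : 'rV[R]_n -> R) (i : 'I_n) : c1c f ->
  forall e : R, 0 < e -> exists2 d : R, 0 < d & forall (x : 'rV[R]_n) (h : R), 0 < h < d ->
   `|f (h *: ebasis i + x) - f x - h * partial i f x| <= h * e.
Proof.
move=> cf e e0; have [ccf df cp] := cf.
have [d d0 hd] := cc_unif (cc_partial i cf) e0.
exists d => // x h /andP[h0 hhd].
have [s _||c ch] := @MVT R (fun s => f (s *: ebasis i + x))
  (fun s => partial i f (s *: ebasis i + x)) 0 h h0.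
- by apply: is_derive_line; exact: df.
- apply: continuous_subspaceT => s; apply: continuous_comp; last exact: ccf.1.
  by apply: continuousD; [apply: scalel_continuous|exact: cst_continuous].
rewrite scale0r add0r subr0 => ->; rewrite mulrC -mulrBr normrM gtr0_norm// ler_pM2l// ltW//.
apply: hd; rewrite addrK normrZ.
move: ch; rewrite in_itv /= => /andP[c0 ch].
rewrite gtr0_norm//; move: (ebasis_norm_le i : `|ebasis i : 'rV[R]_n| <= 1).
by move: (normr_ge0 (ebasis i : 'rV[R]_n)); nra.
Qed.

(** Differentiation under the integral in quantitative form: the uniform remainder is integrated
    over a cube containing both supports. *)
Lemma slice_increment {R : realType} {n : nat} (f : 'rV[R]_n.+1 -> R) : c1c f ->
  forall e : R, 0 < e -> exists2 d : R, 0 < d & forall t h : R, 0 < h < d ->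
   integral_Rn (fun y => `|slice (h + t) f y - slice t f y - h * slice t (partial ord0 f) y|) <= h * e.
Proof.
move=> cf e e0; have [ccf _ _] := cf.
have [M1 M10 hM1] := cc_supp ccf.
have [M2 M20 hM2] := cc_supp (cc_partial ord0 cf).
pose M := Num.max M1 M2.
have M0 : 0 <= M by rewrite le_max M10.
have C0 : 0 < (2 * M) ^+ n + 1 by rewrite ltr_pwDr// exprn_ge0// mulr_ge0.
have [d d0 hd] := partial_increment ord0 cf (divr_gt0 e0 C0).
exists d => // t h hh; have /andP[h0 _] := hh.
apply: le_trans (ler_norm _) _.
apply: le_trans (integral_Rn_bound (c := h * (e / ((2 * M) ^+ n + 1))) (M := M) _ _ _ _) _ => //.
- apply: cc_norm; apply: ccB; first by apply: ccB; exact: cc_slice.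
  by apply: ccZ; apply: cc_slice; exact: cc_partial.
- move=> y; rewrite gt_max => /andP[y1 y2]; rewrite /slice.
  rewrite hM1 ?(lt_le_trans y1 (row_mx_normr _ _))//.
  rewrite hM1 ?(lt_le_trans y1 (row_mx_normr _ _))//.
  by rewrite hM2 ?(lt_le_trans y2 (row_mx_normr _ _))// mulr0 !subr0 normr0.
- by move=> y; rewrite normr_id /slice row_mx_shift0; exact: hd.
rewrite -mulrA ler_pM2l// mulrAC ler_pdivrMr// ler_pM2l// lerDl ler01 //.
Qed.

(** The L^1 norm of a slice is 0 far to the left and grows at a rate of at most the L^1 norm of the
    slice of the first partial derivative. Since |f| need not be differentiable, only the one-sided
    comparison is available, and it is enough. *)
Lemma integral_slice_le {R : realType} {n : nat} (f : 'rV[R]_n.+1 -> R) t : c1c f ->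
  integral_Rn (fun y => `|slice t f y|) <= integral_Rn (fun x => `|partial ord0 f x|).
Proof.
move=> cf; have [ccf _ _] := cf.
have ccp := cc_partial ord0 cf.
have [M M0 hM] := cc_supp ccf.
(* A starting point that is both outside the support and to the left of [t]. *)
pose a := Num.min (- M - 1) t.
have at_ : a <= t by rewrite ge_min lexx orbT.
have aM : M < `|a|.
  have : a <= - M - 1 by rewrite ge_min lexx.
  by move=> h; rewrite ltr0_norm; lra.
have cpsi := cc1_slice (cc_norm ccp).
pose psi s := integral_Rn (slice s (fun x => `|partial ord0 f x|)).
pose phi s := integral_Rn (slice s (fun x => `|f x|)).
have : phi t - phi a <= \int[@lebesgue_measure R]_(s in `[a, t]) psi s.
  apply: increment_le_Rintegral => // e e0.
  have [d d0 hd] := slice_increment cf e0; exists d => // s h hh.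
  have := hd s h hh; set D := fun y => _ => hD.
  have /andP[h0 _] := hh.
  have ccD_ : cc D.
    apply: cc_norm; apply: ccB; first by apply: ccB; exact: cc_slice.
    by apply: ccZ; apply: cc_slice.
  rewrite mulrDr /phi /psi -integral_RnZ; last exact/cc_slice/cc_norm.
  rewrite -integral_RnB; [|exact/cc_slice/cc_norm|exact/cc_slice/cc_norm].
  apply: le_trans (le_integral_Rn (g := fun y => h * slice s (fun x => `|partial ord0 f x|) y + D y) _ _ _) _.
  - by apply: ccB; exact/cc_slice/cc_norm.
  - by apply: ccD => //; apply: ccZ; exact/cc_slice/cc_norm.
  - move=> y; rewrite /D /slice.
    set A := f _; set B := f _; set P := partial _ _ _.
    (* The forward increment |A| - |B| is at most |h P| plus the Taylor remainder, whose integral is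
       already controlled. *)
    have : `|A| <= `|A - B - h * P| + `|B| + `|h * P|.
      rewrite [X in `|X| <= _](_ : A = (A - B - h * P) + B + h * P); last by ring.
      apply: le_trans (ler_normD _ _) _; rewrite lerD2r; exact: ler_normD.
    by rewrite normrM (gtr0_norm h0); lra.
  rewrite integral_RnD ?lerD2l//.
  by apply: ccZ; exact/cc_slice/cc_norm.
have -> : phi a = 0.
  rewrite /phi (_ : slice a _ = fun=> 0) ?integral_Rn0//.
  apply/funext => y; rewrite /slice hM ?normr0//.
  exact: lt_le_trans aM (row_mx_norml _ _).
rewrite subr0 => /le_trans; apply.
have psi0 s : 0 <= psi s.
  by apply: integral_Rn_ge0; [exact/cc_slice/cc_norm|move=> y; exact: normr_ge0].
rewrite [leRHS]/= Rintegral_mkcond.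
apply: le_Rintegral => //.
- rewrite -restrict_EFin -integrable_mkcond//.
  exact: cc1_integrable_itv cpsi.1.
- exact: cc1_integrable cpsi.
- by move=> s _; rewrite patchE; case: ifPn => // _; exact: psi0.
Qed.

(** For a variable other than the first, differentiation commutes with slicing and the induction
    hypothesis kills every slice. For the first variable, the integrals over slices form a function
    that vanishes at both ends of a large interval and has the integrand as derivative. *)
Lemma integral_partial_eq0 {R : realType} {n : nat} (f : 'rV[R]_n -> R) (i : 'I_n) :
  c1c f -> integral_Rn (partial i f) = 0.
Proof.
elim: n f i => [f []//|n IH f i cf].
have [ccf _ _] := cf; have ccp := cc_partial ord0 cf.
case: (unliftP ord0 i) => [j|] -> /=.
  (* The iterated integral in dimension 1 unfolds to the outer integral of 0. *)
  transitivity (@integral_Rn R 1 (fun=> 0)); last exact: integral_Rn0.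
  apply: eq_Rintegral => t _; rewrite -/(slice t _) -partial_slice.
  by apply: IH; exact: c1c_slice.
pose psi s := integral_Rn (slice s (partial ord0 f)).
pose phi s := integral_Rn (slice s f).
have cpsi : cc1 psi by apply: cc1_slice.
have [M M0 hM] := cc_supp ccf.
have [N N0 hN] := cc_supp ccp.
pose b := Num.max M N + 1.
have [bM bN] : M < b /\ N < b.
  by split; rewrite /b; apply: (le_lt_trans (y := Num.max M N)); rewrite ?le_max ?lexx ?orbT// ltrDl.
have phi0 s : b <= `|s| -> phi s = 0.
  move=> bs; rewrite /phi (_ : slice s _ = fun=> 0) ?integral_Rn0//.
  apply/funext => y; rewrite /slice hM//.
  by apply: lt_le_trans (row_mx_norml _ _); lra.
have psi0 s : b < `|s| -> psi s = 0.
  move=> bs; rewrite /psi (_ : slice s _ = fun=> 0) ?integral_Rn0//.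
  apply/funext => y; rewrite /slice hN//.
  by apply: lt_le_trans (row_mx_norml _ _); lra.
have phib : phi b = 0 by apply: phi0; rewrite ger0_norm; lra.
have phia : phi (- b) = 0 by apply: phi0; rewrite normrN ger0_norm; lra.
change (\int[@lebesgue_measure R]_t psi t = 0).
rewrite (Rintegral_supp (lexx _) (lexx _) psi0).
have incr (e : R) : 0 < e -> exists2 d : R, 0 < d & forall t h : R, 0 < h < d ->
    `|phi (h + t) - phi t - h * psi t| <= h * e.
  move=> e0; have [d d0 hd] := slice_increment cf e0; exists d => // t h hh.
  apply: le_trans (hd t h hh).
  rewrite /phi /psi -integral_RnZ; last exact: cc_slice.
  rewrite -integral_RnB; [|exact: cc_slice|exact: cc_slice].
  rewrite -integral_RnB; [|by apply: ccB; exact: cc_slice|by apply: ccZ; exact: cc_slice].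
  apply: le_norm_integral_Rn; apply: ccB; first by apply: ccB; exact: cc_slice.
  by apply: ccZ; exact: cc_slice.
(* The comparison theorem is one-sided, so it is applied to the pair [phi], [psi] and to its
   negative. *)
apply/eqP; rewrite eq_le; apply/andP; split.
  have cpsiN : cc1 (fun s => - psi s).
    split; first by move=> s; apply: continuousN; exact: cpsi.1.
    have [K K0 hK] := cpsi.2; exists K => // s Ks; by rewrite hK// oppr0.
  have := @increment_le_Rintegral R (fun s => - phi s) (fun s => - psi s) (- b) b cpsiN.
  have -> : \int[@lebesgue_measure R]_(t in `[- b, b]) (- psi t) =
     - \int[@lebesgue_measure R]_(t in `[- b, b]) psi t.
    rewrite -[RHS]mulN1r.
    have <- : \int[@lebesgue_measure R]_(t in `[- b, b]) (-1 * psi t) =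
      -1 * \int[@lebesgue_measure R]_(t in `[- b, b]) psi t.
      by apply: RintegralZl => //; exact: cc1_integrable_itv cpsi.1.
    by apply: eq_Rintegral => t _; rewrite mulN1r.
  rewrite phib phia subrr => h; rewrite -oppr_ge0; apply: h; first lra.
  move=> e e0; have [d d0 hd] := incr e e0; exists d => // t h hh.
  by have := hd t h hh; rewrite ler_norml => /andP[]; lra.
have := @increment_le_Rintegral R phi psi (- b) b cpsi.
rewrite phib phia subrr; apply; first lra.
move=> e e0; have [d d0 hd] := incr e e0; exists d => // t h hh.
by have := hd t h hh; rewrite ler_norml => /andP[]; lra.
Qed.
(** * Hoelder and Gagliardo-Nirenberg-Sobolev inequalities *)

Lemma powRV {R : realType} (a r : R) : 0 < a -> powR a^-1 r = (powR a r)^-1.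
Proof. by move=> a0; rewrite -powR_inv1 ?ltW// -powRrM mulN1r powRN. Qed.

(** Away from 0 the power is differentiable; at 0 the modulus e^(1/r) is explicit. *)
Lemma continuous_powR_norm {R : realType} (r : R) : 0 < r ->
  continuous (fun s : R => powR `|s| r).
Proof.
move=> r0 s; have [->|s0] := eqVneq s 0.
  rewrite /continuous_at normr0 powR0 ?gt_eqF//.
  apply/(@cvgrPdist_lt _ _ _ (nbhs (0 : R))) => e e0.
  apply/nbhs_ballP; exists (powR e r^-1) => /=; first by rewrite powR_gt0.
  move=> t; rewrite -ball_normE /= !sub0r !normrN => te.
  rewrite (ger0_norm (powR_ge0 _ _)).
  have -> : e = powR (powR e r^-1) r by rewrite -powRrM mulVf ?gt_eqF// powRr1// ltW.
  by rewrite gt0_ltr_powR// ?nnegrE ?powR_ge0.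
apply: (@continuous_comp _ _ _ (fun s : R => `|s|) (fun s => powR s r)).
  exact: norm_continuous.
apply: differentiable_continuous; apply/derivable1_diffP.
by apply: derivable_powR; rewrite in_itv /= normr_gt0 s0.
Qed.

Lemma cc_powR {R : realType} {n : nat} (r : R) (f : 'rV[R]_n -> R) : 0 < r ->
  cc f -> cc (fun x => powR `|f x| r).
Proof.
move=> r0; apply: (@cc_comp _ _ (fun s => powR `|s| r)).
  exact: continuous_powR_norm.
by rewrite normr0 powR0 ?gt_eqF.
Qed.

(** Young's inequality for f/F and g/G. Upper bounds [F] and [G] stand in for the norms, so that
    known estimates can be inserted directly and a vanishing norm needs no case of its own. *)
Lemma hoelder_integral_Rn {R : realType} {n : nat} (f g : 'rV[R]_n -> R) (p q F G : R) :
  0 < p -> 0 < q -> p^-1 + q^-1 = 1 ->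
  cc f -> cc g -> (forall x, 0 <= f x) -> (forall x, 0 <= g x) -> 0 <= F -> 0 <= G ->
  integral_Rn (fun x => powR (f x) p) <= powR F p ->
  integral_Rn (fun x => powR (g x) q) <= powR G q ->
  integral_Rn (fun x => f x * g x) <= F * G.
Proof.
move=> p0 q0 pq cf cg f0 g0 F0 G0 fF gG.
have cfp : cc (fun x => powR (f x) p).
  have -> : (fun x => powR (f x) p) = (fun x => powR `|f x| p).
    by apply/funext => x; rewrite ger0_norm.
  exact: cc_powR.
have cgq : cc (fun x => powR (g x) q).
  have -> : (fun x => powR (g x) q) = (fun x => powR `|g x| q).
    by apply/funext => x; rewrite ger0_norm.
  exact: cc_powR.
have pos (F' G' : R) : 0 < F' -> 0 < G' -> F <= F' -> G <= G' ->
    integral_Rn (fun x => f x * g x) <= F' * G'.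
  move=> F'0 G'0 FF GG.
  (* Young's majorant of [f * g]; its integral is at most F'G'(1/p + 1/q) = F'G'. *)
  pose h x := F' * G' * (powR F' p * p)^-1 * powR (f x) p +
    F' * G' * (powR G' q * q)^-1 * powR (g x) q.
  have ch : cc h by apply: ccD; exact: ccZ.
  apply: le_trans (le_integral_Rn (g := h) _ ch _) _.
  - by apply: ccMr => //; exact: cf.1.
  - move=> x; rewrite /h.
    have := conjugate_powR (divr_ge0 (f0 x) (ltW F'0)) (divr_ge0 (g0 x) (ltW G'0)) p0 q0 pq.
    rewrite !powRM ?invr_ge0 ?(ltW F'0) ?(ltW G'0)//.
    rewrite !powRV//.
    move=> le; have FG0 : 0 < F' * G' by rewrite mulr_gt0.
    have -> : f x * g x = F' * G' * (f x / F' * (g x / G')).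
      by field; rewrite !gt_eqF.
    apply: le_trans (ler_wpM2l (ltW FG0) le) _.
    by rewrite le_eqVlt; apply/orP; left; apply/eqP; field; rewrite !gt_eqF ?powR_gt0.
  rewrite /h integral_RnD; [|exact: ccZ|exact: ccZ].
  rewrite !integral_RnZ//.
  have h1 : integral_Rn (fun x => powR (f x) p) <= powR F' p.
    by apply: le_trans fF _; apply: ge0_ler_powR => //; rewrite ?nnegrE// ltW.
  have h2 : integral_Rn (fun x => powR (g x) q) <= powR G' q.
    by apply: le_trans gG _; apply: ge0_ler_powR => //; rewrite ?nnegrE// ltW.
  have Fp := powR_gt0 p F'0; have Gq := powR_gt0 q G'0.
  have FGE : F' * G' = F' * G' * (powR F' p * p)^-1 * powR F' p +
                     F' * G' * (powR G' q * q)^-1 * powR G' q.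
    transitivity (F' * G' * (p^-1 + q^-1)); first by rewrite pq mulr1.
    by field; rewrite !gt_eqF.
  by rewrite [leRHS]FGE; apply: lerD; apply: ler_wpM2l => //; rewrite mulr_ge0// ?invr_ge0 mulr_ge0// ltW.
apply/ler_addgt0Pr => e e0.
(* Enlarging both bounds by [d] makes them positive and adds d(F + G + d) to the product, which is
   at most [e] because d is at most 1. *)
pose d := Num.min 1 (e / (F + G + 1)).
have FG1 : 0 < F + G + 1 by lra.
have d0 : 0 < d by rewrite lt_min ltr01 divr_gt0.
have d1 : d <= 1 by rewrite ge_min lexx.
have de : d * (F + G + 1) <= e by rewrite -ler_pdivlMr// ge_min lexx orbT.
apply: le_trans (pos (F + d) (G + d) _ _ _ _) _; try lra.
by nra.
Qed.

Definition sum_partial {R : realType} {n : nat} (v : 'rV[R]_n -> R) (x : 'rV[R]_n) : R :=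
  \sum_(i < n) `|partial i v x|.

Lemma cc_sum_partial {R : realType} {n : nat} (v : 'rV[R]_n -> R) :
  c1c v -> cc (sum_partial v).
Proof. by move=> cv; apply: cc_sum => i _; apply: cc_norm; exact: cc_partial. Qed.

Lemma sum_partial_ge0 {R : realType} {n : nat} (v : 'rV[R]_n -> R) x : 0 <= sum_partial v x.
Proof. by apply: sumr_ge0 => i _; exact: normr_ge0. Qed.

(* The Sobolev exponent d / (d - 1) in dimension d = n + 2. *)
Definition gns_exp {R : realType} (n : nat) : R := 1 + n.+1%:R^-1.

(* For a slice [u] of a function in one more variable, [A] will be the integral
   of the derivative in that variable, which bounds the L^1 norm of every slice. *)
Definition gns_interpolation {R : realType} (n : nat) : Prop :=
  forall (u : 'rV[R]_n.+1 -> R) (A : R), c1c u -> 0 <= A ->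
  integral_Rn (fun y => `|u y|) <= A ->
  integral_Rn (fun y => powR `|u y| (gns_exp n)) <=
  powR A n.+1%:R^-1 * integral_Rn (sum_partial u).

Definition gns_inequality {R : realType} (n : nat) : Prop :=
  forall v : 'rV[R]_n.+2 -> R, c1c v ->
  integral_Rn (fun x => powR `|v x| (gns_exp n)) <=
  powR (integral_Rn (sum_partial v)) (gns_exp n).

Lemma gns_exp_gt0 {R : realType} (n : nat) : 0 < gns_exp n :> R.
Proof. by rewrite addr_gt0// invr_gt0. Qed.

Lemma powR_gns_exp {R : realType} (n : nat) (a : R) : 0 <= a ->
  powR a (gns_exp n) = powR a n.+1%:R^-1 * a.
Proof.
move=> a0; have h : 0 < n.+1%:R^-1 + 1 :> R by rewrite addr_gt0// invr_gt0.
by rewrite /gns_exp addrC powRD ?powRr1// gt_eqF.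
Qed.

(** On the line the exponent is 2, and |u|^2 is at most |u| times the supremum of |u|, which the
    integral of |u'| bounds. *)
Lemma gns_interpolation0 {R : realType} : @gns_interpolation R 0.
Proof.
move=> u A cu A0 uA; have [ccu _ _] := cu.
have sup y : `|u y| <= integral_Rn (sum_partial u).
  have -> : sum_partial u = (fun x => `|partial ord0 u x|).
    by apply/funext => x; rewrite /sum_partial big_ord_recl big_ord0 addr0.
  (* A slice of a function of one variable lives on R^0, where the integral is evaluation; the L^1
     bound on slices thus becomes a pointwise bound. *)
  have -> : u y = slice (y 0 0) u 0.
    rewrite /slice; congr u; apply/rowP => i; rewrite ord1.
    by rewrite (row_mx_ord0 (y 0 0) (0 : 'rV[R]_0)).
  exact: (integral_slice_le (y 0 0) cu).
have e2 : @gns_exp R 0 = 2 by rewrite /gns_exp invr1.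
have -> : (fun y => powR `|u y| (gns_exp 0)) = (fun y => `|u y| * `|u y|).
  by apply/funext => y; rewrite e2 powR_mulrn// expr2.
rewrite invr1 powRr1//.
apply: le_trans (le_integral_Rn (g := fun y => integral_Rn (sum_partial u) * `|u y|) _ _ _) _.
- by apply: ccMr; [exact: (cc_norm ccu).1|exact: cc_norm].
- by apply: ccZ; exact: cc_norm.
- by move=> y; apply: ler_wpM2r.
rewrite integral_RnZ; last exact: cc_norm.
rewrite mulrC; apply: ler_wpM2r => //.
by apply: integral_Rn_ge0; [exact: cc_sum_partial|exact: sum_partial_ge0].
Qed.

(** With [A] the integral of all partial derivatives, every slice has L^1 norm at most [A].
    Integrating the slice inequality over the first variable yields A^(1/(n+1)) times at most [A],
    which is [A] to the power [gns_exp n]. *)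
Lemma gns_inequality_of_interpolation {R : realType} (n : nat) :
  @gns_interpolation R n -> @gns_inequality R n.
Proof.
move=> H v cv; have [ccv _ _] := cv.
pose S x : R := \sum_(j < n.+1) `|partial (lift ord0 j) v x|.
have cS : cc S by apply: cc_sum => i _; apply: cc_norm; exact: cc_partial.
have cs := cc_sum_partial cv.
have sE x : sum_partial v x = `|partial ord0 v x| + S x.
  by rewrite /sum_partial big_ord_recl.
set A := integral_Rn (sum_partial v).
have A0 : 0 <= A by apply: integral_Rn_ge0 => // x; exact: sum_partial_ge0.
have c0 := cc_norm (cc_partial ord0 cv).
have dA : integral_Rn (fun x => `|partial ord0 v x|) <= A.
  apply: le_integral_Rn => // x; rewrite sE lerDl.
  by apply: sumr_ge0 => i _; exact: normr_ge0.
have SA : integral_Rn S <= A.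
  by apply: le_integral_Rn => // x; rewrite sE lerDr.
have r0 := @gns_exp_gt0 R n.
have cvr := cc_powR r0 ccv.
rewrite (powR_gns_exp _ A0).
apply: (@le_trans _ _ (powR A n.+1%:R^-1 * integral_Rn S)); last first.
  by apply: ler_wpM2l => //; exact: powR_ge0.
rewrite -integral_RnZ//.
apply: le_Rintegral; [by []| | |].
- exact: cc1_integrable (cc1_slice cvr).
- exact: (cc1_integrable (cc1_slice (ccZ _ cS))).
move=> t _.
change (integral_Rn (fun y => powR `|slice t v y| (gns_exp n)) <=
  integral_Rn (fun y => powR A n.+1%:R^-1 * slice t S y)).
rewrite (integral_RnZ _ (cc_slice t cS)).
have -> : slice t S = sum_partial (slice t v).
  by apply/funext => y; rewrite /slice /S /sum_partial; apply: eq_bigr => j _; rewrite partial_slice.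
apply: (H (slice t v)) => //; first exact: c1c_slice.
exact: le_trans (integral_slice_le t cv) dA.
Qed.

(** Hoelder for |u|^(1/(n+2)) times |u|, with exponent n+2 on the first factor, giving the L^1 norm,
    and the conjugate exponent (n+2)/(n+1) = [gns_exp n] on the second, where the Sobolev inequality
    applies. *)
Lemma gns_interpolationS {R : realType} (n : nat) :
  @gns_inequality R n -> @gns_interpolation R n.+1.
Proof.
move=> H u A cu A0 uA; have [ccu _ _] := cu.
have n2 : 0 < n.+2%:R :> R by rewrite ltr0Sn.
have -> : (fun y => powR `|u y| (gns_exp n.+1)) = (fun y => powR `|u y| n.+2%:R^-1 * `|u y|).
  by apply/funext => y; rewrite powR_gns_exp.
apply: (@hoelder_integral_Rn _ _ _ _ n.+2%:R (gns_exp n)) => //.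
- exact: gns_exp_gt0.
- rewrite /gns_exp -!natr1; field.
  by apply/andP; split; apply: lt0r_neq0; have := ler0n R n; lra.
- by apply: cc_powR => //; rewrite invr_gt0.
- exact: cc_norm.
- exact: powR_ge0.
- by apply: integral_Rn_ge0; [exact: cc_sum_partial|exact: sum_partial_ge0].
- rewrite -[leRHS]powRrM mulVf ?gt_eqF// powRr1//.
  apply: le_trans uA; rewrite le_eqVlt; apply/orP; left; apply/eqP.
  by congr integral_Rn; apply/funext => x; rewrite -powRrM mulVf ?gt_eqF// powRr1.
- exact: H.
Qed.

Lemma gagliardo_nirenberg_sobolev {R : realType} (n : nat) : @gns_inequality R n.
Proof.
apply: gns_inequality_of_interpolation.
elim: n => [|n IH]; first exact: gns_interpolation0.
by apply: gns_interpolationS; exact: gns_inequality_of_interpolation.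
Qed.
(** * Calculus on the half-space *)

Lemma expR_sum_nat {R : realType} {I : Type} (r : seq I) (F : I -> R) :
  expR (\sum_(i <- r) F i) = \prod_(i <- r) expR (F i).
Proof. by elim: r => [|i r IH]; rewrite ?big_nil ?expR0// !big_cons expRD IH. Qed.

(** The one-variable chain rule along the line through [x] in direction [v]; no differentiability of
    [f] beyond that direction is needed. *)
Lemma is_derive_comp {R : realType} {V : normedModType R} (f : V -> R) (g : R -> R)
  (x v : V) (df dg : R) :
  is_derive x v f df -> is_derive (f x) 1 g dg ->
  is_derive x v (fun y => g (f y)) (dg * df).
Proof.
move=> hf hg.
have x0 : 0 *: v + x = x by rewrite scale0r add0r.
have h1 : is_derive (0 : R) 1 (fun h => f (h *: v + x)) df.
  have [df1 <-] := hf; rewrite -[in X in 'D_v f X]x0; apply: is_derive_line.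
  by rewrite x0.
have h2 : is_derive (f (0 *: v + x)) 1 g dg by rewrite x0.
have := @is_derive1_comp R g (fun h => f (h *: v + x)) 0 dg df h2 h1.
move=> [d1 d2].
have e : (fun h : R => h^-1 *: (g (f (h *: v + x)) - g (f x))) =
  (fun h : R => h^-1 *: ((g \o (fun h => f (h *: v + x))) (h *: 1 + 0) -
     (g \o (fun h => f (h *: v + x))) 0)).
  by apply/funext => h /=; rewrite addr0 [h *: 1]mulr1 x0.
apply: DeriveDef; first by rewrite /derivable e.
by rewrite /derive e.
Qed.

Lemma is_derive_big {R : realType} {V : normedModType R} {I : Type} (r : seq I)
  (P : pred I) (h : I -> V -> R) (dh : I -> R) (x v : V) :
  (forall i, P i -> is_derive x v (h i) (dh i)) ->
  is_derive x v (fun y => \sum_(i <- r | P i) h i y) (\sum_(i <- r | P i) dh i).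
Proof.
move=> H; elim: r => [|i r IH].
  by rewrite big_nil; under eq_fun do rewrite big_nil; exact: is_derive_cst.
rewrite big_cons; under eq_fun do rewrite big_cons.
case Pi: (P i); last exact: IH.
exact: (is_deriveD (H i Pi) IH).
Qed.

Lemma continuous_near {R : realType} {n : nat} (f g : 'rV[R]_n -> R) (x : 'rV[R]_n) :
  {near x, f =1 g} -> {for x, continuous g} -> {for x, continuous f}.
Proof.
move=> fg; rewrite /prop_for /continuous_at (nbhs_singleton fg) => cg.
have gf : \forall y \near x, g y = f y by apply: filterS fg => y ->.
exact: cvg_trans (near_eq_cvg gf) cg.
Qed.

Lemma continuous_ext {R : realType} {n : nat} (f g : 'rV[R]_n -> R) (x : 'rV[R]_n) :
  f =1 g -> {for x, continuous g} -> {for x, continuous f}.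
Proof. by move=> /funext ->. Qed.

Lemma continuous_big {R : realType} {n : nat} {I : Type} (r : seq I) (P : pred I)
  (h : I -> 'rV[R]_n -> R) (x : 'rV[R]_n) :
  (forall i, P i -> {for x, continuous (h i)}) ->
  {for x, continuous (fun y => \sum_(i <- r | P i) h i y)}.
Proof.
move=> H; elim: r => [|i r IH].
  apply: (@continuous_ext _ _ _ (fun=> 0)); last exact: cst_continuous.
  by move=> y; rewrite big_nil.
case Pi: (P i).
  apply: (@continuous_ext _ _ _ (fun y => h i y + \sum_(j <- r | P j) h j y)).
    by move=> y; rewrite big_cons Pi.
  exact: (continuousD (H i Pi) IH).
apply: (@continuous_ext _ _ _ (fun y => \sum_(j <- r | P j) h j y)) => //.
by move=> y; rewrite big_cons Pi.
Qed.

Lemma near_coord_gt {R : realType} {n : nat} (x : 'rV[R]_n.+1) (c : R) :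
  c < x 0 ord0 -> \forall y \near x, c < (y : 'rV[R]_n.+1) 0 ord0.
Proof.
move=> cx; have := @coord_continuous R 1 n.+1 0 ord0 x.
by move/cvgr_gt/(_ _ cx).
Qed.

Lemma near_coord_lt {R : realType} {n : nat} (x : 'rV[R]_n.+1) (c : R) :
  x 0 ord0 < c -> \forall y \near x, (y : 'rV[R]_n.+1) 0 ord0 < c.
Proof.
move=> cx; have := @coord_continuous R 1 n.+1 0 ord0 x.
by move/cvgr_lt/(_ _ cx).
Qed.

Lemma is_derive_coord {R : realType} {n : nat} (i j : 'I_n) (x : 'rV[R]_n) :
  is_derive x (ebasis i) (fun y : 'rV[R]_n => y 0 j) (i == j)%:R.
Proof.
have e : (fun h : R => h^-1 *: ((h *: ebasis i + x) 0 j - x 0 j)) =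
         (fun h : R => h^-1 *: (h * (i == j)%:R)).
  apply/funext => h; rewrite !mxE eqxx /= addrK eq_sym //.
have l : (fun h : R => h^-1 *: ((h *: ebasis i + x) 0 j - x 0 j)) @ 0^' --> ((i == j)%:R : R).
  rewrite e; apply/(@cvgrPdist_lt _ _ _ (0^')) => eps eps0.
  near=> h; rewrite /GRing.scale /= mulKf ?subrr ?normr0//.
  by near: h; exact: nbhs_dnbhs_neq.
apply: DeriveDef; first exact: (cvgP _ l).
exact: (cvg_lim _ l).
Unshelve. all: by end_near.
Qed.

Section half_space_calculus.
Context {R : realType} {n : nat}.
Implicit Types (f g u : 'rV[R]_n.+1 -> R) (x : 'rV[R]_n.+1).

(** Regularity is required only where x_1 > 0, because the weight may blow up at x_1 = 0. *)
Definition c0on f := forall x, 0 < x 0 ord0 -> {for x, continuous f}.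

Definition c1on f := [/\ c0on f,
  forall i x, 0 < x 0 ord0 -> derivable f x (ebasis i) &
  forall i, c0on (partial i f)].

(** The strip x_1 < [eps] reaches across the boundary hyperplane, which is what allows extension by
    zero. *)
Definition hsupp (M : R) (eps : R) f := forall x, M < `|x| \/ x 0 ord0 < eps -> f x = 0.

Lemma c0onM f g : c0on f -> c0on g -> c0on (fun x => f x * g x).
Proof. by move=> cf cg x x0; apply: continuousM; [exact: cf|exact: cg]. Qed.

Lemma c0onD f g : c0on f -> c0on g -> c0on (fun x => f x + g x).
Proof. by move=> cf cg x x0; apply: continuousD; [exact: cf|exact: cg]. Qed.

Lemma c0on_comp (th : R -> R) f : continuous th -> c0on f -> c0on (fun x => th (f x)).
Proof. by move=> cth cf x x0; apply: continuous_comp; [exact: cf|exact: cth]. Qed.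

Lemma c0on_coord (i : 'I_n.+1) : c0on (fun x => x 0 i).
Proof. by move=> x _; exact: coord_continuous. Qed.

Lemma c0on_sum {I : Type} (r : seq I) (P : pred I) (h : I -> 'rV[R]_n.+1 -> R) :
  (forall i, P i -> c0on (h i)) -> c0on (fun x => \sum_(i <- r | P i) h i x).
Proof. by move=> H x x0; apply: continuous_big => i Pi; exact: H. Qed.

Lemma hsuppMr M eps f g : hsupp M eps g -> hsupp M eps (fun x => f x * g x).
Proof. by move=> hg x hx; rewrite hg// mulr0. Qed.

(** A point with x_1 at most 0 has a neighbourhood inside the open set x_1 < [eps], on which the
    function is identically 0. *)
Lemma c0on_cc M eps f : 0 < eps -> c0on f -> hsupp M eps f -> cc f.
Proof.
move=> e0 cf hf; split; last by exists M => x Mx; apply: hf; left.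
move=> x; have [x0|x0] := ltP 0 (x 0 ord0); first exact: cf.
apply: (@continuous_near _ _ f (fun=> 0)); last exact: cst_continuous.
have := near_coord_lt (le_lt_trans x0 e0).
by apply: filterS => y ye; apply: hf; right.
Qed.

Lemma hsupp_partial M eps f i : hsupp M eps f -> hsupp M eps (partial i f).
Proof.
move=> hf x hx; rewrite -(partial_cst i 0 x); apply: near_eq_partial.
case: hx => hx.
  by have := near_norm_gt hx; apply: filterS => y ye; apply: hf; left.
by have := near_coord_lt hx; apply: filterS => y ye; apply: hf; right.
Qed.

Lemma c1on_c1c M eps f : 0 < eps -> c1on f -> hsupp M eps f -> c1c f.
Proof.
move=> e0 [cf df cp] hf; split; first exact: (c0on_cc e0 cf hf).
  move=> i x; have [x0|x0] := ltP 0 (x 0 ord0); first exact: df.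
  have near0 : {near x, (fun=> 0) =1 f}.
    have := near_coord_lt (le_lt_trans x0 e0).
    by apply: filterS => y ye; rewrite hf//; right.
  by apply: near_eq_derivable near0 _; exact: derivable_cst.
by move=> i; exact: (c0on_cc e0 (cp i) (hsupp_partial i hf)).1.
Qed.

Lemma c1on_of_derive f (df : 'I_n.+1 -> 'rV[R]_n.+1 -> R) :
  c0on f -> (forall i x, 0 < x 0 ord0 -> is_derive x (ebasis i) f (df i x)) ->
  (forall i, c0on (df i)) -> c1on f.
Proof.
move=> cf hd cd; split => //.
  by move=> i x /(hd i)[].
move=> i x x0; apply: (@continuous_near _ _ _ (df i)); last exact: cd.
have := near_coord_gt x0.
by apply: filterS => y /(hd i)[_].
Qed.

Lemma c1on_is_derive f i x : c1on f -> 0 < x 0 ord0 ->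
  is_derive x (ebasis i) f (partial i f x).
Proof. by move=> [_ df _] x0; apply: derivableP; exact: df. Qed.

Lemma c1onM f g : c1on f -> c1on g -> c1on (fun x => f x * g x).
Proof.
move=> cf cg; have [cf0 _ cfp] := cf; have [cg0 _ cgp] := cg.
apply: (@c1on_of_derive _ (fun i x => f x * partial i g x + g x * partial i f x)).
- exact: c0onM.
- by move=> i x x0; exact: (is_deriveM (c1on_is_derive i cf x0) (c1on_is_derive i cg x0)).
- by move=> i; apply: c0onD; exact: c0onM.
Qed.

Lemma partialM f g i x : c1on f -> c1on g -> 0 < x 0 ord0 ->
  partial i (fun x => f x * g x) x = f x * partial i g x + g x * partial i f x.
Proof.
move=> cf cg x0.
by have [_ h] := (is_deriveM (c1on_is_derive i cf x0) (c1on_is_derive i cg x0)); exact: h.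
Qed.

Lemma c1on_comp (th dth : R -> R) f :
  (forall s : R, is_derive s 1 th (dth s)) -> continuous dth -> c1on f ->
  c1on (fun x => th (f x)).
Proof.
move=> hth cth cf; have [cf0 _ cfp] := cf.
apply: (@c1on_of_derive _ (fun i x => dth (f x) * partial i f x)).
- apply: c0on_comp => // s; apply: differentiable_continuous; apply/derivable1_diffP.
  by have [] := hth s.
- by move=> i x x0; exact: is_derive_comp (c1on_is_derive i cf x0) (hth _).
- by move=> i; apply: c0onM => //; exact: c0on_comp.
Qed.

Lemma partial_comp (th dth : R -> R) f i x :
  (forall s : R, is_derive s 1 th (dth s)) -> c1on f -> 0 < x 0 ord0 ->
  partial i (fun x => th (f x)) x = dth (f x) * partial i f x.
Proof.
by move=> hth cf x0; have [_ h] := is_derive_comp (c1on_is_derive i cf x0) (hth _); exact: h.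
Qed.

Lemma c1on_coord (i : 'I_n.+1) : c1on (fun x => x 0 i).
Proof.
apply: (@c1on_of_derive _ (fun j _ => (j == i)%:R)); first exact: c0on_coord.
- by move=> j x _; exact: is_derive_coord.
- by move=> j x _; exact: cst_continuous.
Qed.

Lemma partial_coord (i j : 'I_n.+1) x : partial i (fun x => x 0 j) x = (i == j)%:R.
Proof. by have [_ h] := is_derive_coord i j x; exact: h. Qed.

Definition normsq (j : nat) x : R := \sum_(i < n.+1 | (i < j)%N) x 0 i ^+ 2.

Lemma normsq_gt0 j x : (0 < j)%N -> 0 < x 0 ord0 -> 0 < normsq j x.
Proof.
move=> j0 x0; rewrite /normsq (bigD1 ord0)//=.
by rewrite ltr_pwDl ?exprn_gt0// sumr_ge0// => i _; exact: sqr_ge0.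
Qed.

Lemma normX_gt0 j x : (0 < j)%N -> 0 < x 0 ord0 -> 0 < normX j x.
Proof. by move=> j0 x0; rewrite sqrtr_gt0 normsq_gt0. Qed.

Lemma c0on_normsq j : c0on (normsq j).
Proof.
apply: c0on_sum => i _; apply: (c0on_comp (th := fun s => s ^+ 2)).
  exact: exprn_continuous.
exact: c0on_coord.
Qed.

Lemma is_derive_normsq j i x :
  is_derive x (ebasis i) (normsq j) (2 * (x 0 i *+ (i < j)%N)).
Proof.
have -> : 2 * (x 0 i *+ (i < j)%N) =
    \sum_(l < n.+1 | (l < j)%N) 2 * x 0 l * (i == l)%:R.
  rewrite big_mkcond (bigD1 i)//= eqxx big1 ?addr0.
    by case: (i < j)%N; rewrite ?mulr1 ?mulr0n ?mulr0.
  by move=> l li; rewrite eq_sym (negbTE li) mulr0; case: ifP.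
apply: is_derive_big => l _.
have -> : 2 * x 0 l * (i == l)%:R = x 0 l * (i == l)%:R + x 0 l * (i == l)%:R by ring.
exact: (is_deriveM (is_derive_coord i l x) (is_derive_coord i l x)).
Qed.

(* The weight with exponents [a], in a form that is easy to differentiate; it
   agrees with [weight] only where x_1 > 0. *)
Definition Pw (k : nat) (a : nat -> R) x : R :=
  expR (\sum_(1 <= j < k.+1) a j / 2 * ln (normsq j x)).

Lemma Pw_gt0 k a x : 0 < Pw k a x. Proof. exact: expR_gt0. Qed.

Lemma normXE j x : (0 < j)%N -> 0 < x 0 ord0 -> normX j x = expR (2^-1 * ln (normsq j x)).
Proof.
move=> j0 x0; have N0 := normsq_gt0 j0 x0.
by rewrite /normX -/(normsq j x) -powR12_sqrt ?ltW// /powR gt_eqF.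
Qed.

Lemma weightE k a x : 0 < x 0 ord0 -> weight k a x = Pw k a x.
Proof.
move=> x0; rewrite /weight /Pw expR_sum_nat; apply: eq_big_nat => j /andP[j0 _].
rewrite normXE// /powR gt_eqF ?expR_gt0// expRK; congr expR; ring.
Qed.

(** Logarithmic differentiation: the factor with exponent [a j] contributes a_j x_i / |X_j|^2 when
    X_j contains the coordinate, which for indices counted from 0 means [i < j]. *)
Lemma is_derive_Pw k a i x : 0 < x 0 ord0 ->
  is_derive x (ebasis i) (Pw k a)
    (Pw k a x * (x 0 i * \sum_(1 <= j < k.+1 | (i < j)%N) a j / normsq j x)).
Proof.
move=> x0.
suff hS : is_derive x (ebasis i) (fun y => \sum_(1 <= j < k.+1) a j / 2 * ln (normsq j y))
    (x 0 i * \sum_(1 <= j < k.+1 | (i < j)%N) a j / normsq j x).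
  exact: (is_derive_comp hS (is_derive_expR _)).
have -> : (x 0 i * \sum_(1 <= j < k.+1 | (i < j)%N) a j / normsq j x) =
   \sum_(1 <= j < k.+1 | (0 < j)%N) a j / 2 * ((normsq j x)^-1 * (2 * (x 0 i *+ (i < j)%N))).
  rewrite big_distrr /= big_mkcond [RHS]big_mkcond; apply: eq_big_nat => j /andP[j0 _].
  rewrite j0; case: (i < j)%N; rewrite ?mulr0n ?mulr0// mulr1n.
  by field; rewrite gt_eqF// normsq_gt0.
(* The bound 0 < j is copied from the range into the predicate, since the sum rule passes on only
   the predicate. *)
have -> : (fun y => \sum_(1 <= j < k.+1) a j / 2 * ln (normsq j y)) =
   (fun y => \sum_(1 <= j < k.+1 | (0 < j)%N) a j / 2 * ln (normsq j y)).
  apply/funext => y; rewrite [RHS]big_mkcond; apply: eq_big_nat => j /andP[j0 _].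
  by rewrite j0.
apply: is_derive_big => j j0.
have h : is_derive x (ebasis i) (fun y => ln (normsq j y)) ((normsq j x)^-1 * (2 * (x 0 i *+ (i < j)%N))).
  apply: is_derive_comp (is_derive_normsq j i x) _.
  by apply: is_derive1_ln; exact: normsq_gt0.
exact: (is_deriveZ (a j / 2) h).
Qed.

Lemma c0on_ln_normsq j : (0 < j)%N -> c0on (fun x => ln (normsq j x)).
Proof.
move=> j0 x x0; apply: continuous_comp; first exact: c0on_normsq.
by apply: continuous_ln; exact: normsq_gt0.
Qed.

Lemma c0on_inv_normsq j : (0 < j)%N -> c0on (fun x => (normsq j x)^-1).
Proof.
move=> j0 x x0; apply: continuousV; last exact: c0on_normsq.
by rewrite gt_eqF// normsq_gt0.
Qed.

Lemma c0on_cst (c : R) : c0on (fun=> c).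
Proof. by move=> x _; exact: cst_continuous. Qed.

Lemma c0on_Pw k a : c0on (Pw k a).
Proof.
apply: c0on_comp; first exact: continuous_expR.
have -> : (fun y => \sum_(1 <= j < k.+1) a j / 2 * ln (normsq j y)) =
   (fun y => \sum_(1 <= j < k.+1 | (0 < j)%N) a j / 2 * ln (normsq j y)).
  apply/funext => y; rewrite [RHS]big_mkcond; apply: eq_big_nat => j /andP[j0 _].
  by rewrite j0.
by apply: c0on_sum => j j0; apply: c0onM; [exact: c0on_cst|exact: c0on_ln_normsq].
Qed.

Lemma c1on_Pw k a : c1on (Pw k a).
Proof.
apply: c1on_of_derive; [exact: c0on_Pw|by move=> i x; exact: is_derive_Pw|].
move=> i; apply: c0onM; first exact: c0on_Pw.
apply: c0onM; first exact: c0on_coord.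
apply: c0on_sum => j ij; apply: c0onM; first exact: c0on_cst.
by apply: c0on_inv_normsq; exact: leq_ltn_trans ij.
Qed.

Lemma partial_Pw k a i x : 0 < x 0 ord0 -> partial i (Pw k a) x =
  Pw k a x * (x 0 i * \sum_(1 <= j < k.+1 | (i < j)%N) a j / normsq j x).
Proof. by move=> x0; have [_ h] := is_derive_Pw k a i x0; exact: h. Qed.

Lemma normX_sqr j x : normX j x ^+ 2 = normsq j x.
Proof. by rewrite sqr_sqrtr// sumr_ge0// => i _; exact: sqr_ge0. Qed.

Lemma normsq_le j l x : (j <= l)%N -> normsq j x <= normsq l x.
Proof.
move=> jl; rewrite /normsq [leLHS]big_mkcond [leRHS]big_mkcond; apply: ler_sum => i _.
case: ifP => ij; first by rewrite (leq_trans ij jl).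
by case: ifP => // _; exact: sqr_ge0.
Qed.

Lemma normX_le j l x : (j <= l)%N -> normX j x <= normX l x.
Proof. by move=> jl; apply: ler_wsqrtr; exact: normsq_le. Qed.

Lemma coord_le_normX j (i : 'I_n.+1) x : (i < j)%N -> `|x 0 i| <= normX j x.
Proof.
move=> ij; rewrite -sqrtr_sqr; apply: ler_wsqrtr.
by rewrite (bigD1 i)//= lerDl sumr_ge0// => l _; exact: sqr_ge0.
Qed.

(* The exponents of the weight divided by |X_l|. *)
Definition shift_exp (sigma : nat -> R) (l j : nat) : R := sigma j - (j == l)%:R.

Lemma Pw_shift k sigma l x : (0 < l <= k)%N -> 0 < x 0 ord0 ->
  Pw k (shift_exp sigma l) x * normX l x = Pw k sigma x.
Proof.
move=> /andP[l0 lk] x0; rewrite normXE// /Pw -expRD; congr expR.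
have -> : 2^-1 * ln (normsq l x) = \sum_(1 <= j < k.+1) (j == l)%:R / 2 * ln (normsq j x).
  transitivity (\sum_(1 <= j < k.+1 | j == l) 2^-1 * ln (normsq j x)).
    by rewrite big_nat1_eq l0 ltnS lk.
  rewrite big_mkcond; apply: eq_big_nat => j _.
  by case: eqP => _; rewrite ?mul1r ?mul0r.
rewrite -big_split; apply: eq_bigr => j _ /=.
by rewrite /shift_exp; ring.
Qed.
End half_space_calculus.
(** * The weighted L^1 Hardy inequality *)

(* A C^1 approximation of the absolute value vanishing at 0, so that composing
   with it preserves supports. *)
Definition smooth_abs {R : realType} (d s : R) : R :=
  Num.sqrt (s ^+ 2 + (d ^+ 2) ^+ 2) - d ^+ 2.

Definition dsmooth_abs {R : realType} (d s : R) : R :=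
  s / Num.sqrt (s ^+ 2 + (d ^+ 2) ^+ 2).

Section smooth_abs_theory.
Context {R : realType} (d : R) (d0 : 0 < d).

Let arg_gt0 (s : R) : 0 < s ^+ 2 + (d ^+ 2) ^+ 2.
Proof. by rewrite ltr_wpDl ?sqr_ge0// !exprn_gt0. Qed.

Lemma smooth_abs0 : smooth_abs d 0 = 0.
Proof. by rewrite /smooth_abs expr0n add0r sqrtr_sqr ger0_norm ?sqr_ge0// subrr. Qed.

Lemma is_derive_smooth_abs (s : R) : is_derive s 1 (smooth_abs d) (dsmooth_abs d s).
Proof.
have h : is_derive s 1 (fun t : R => t ^+ 2 + (d ^+ 2) ^+ 2) (s + s).
  have := is_deriveD (is_deriveM (is_derive_id s 1) (is_derive_id s 1))
    (is_derive_cst ((d ^+ 2) ^+ 2) s 1).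
  by rewrite addr0 /GRing.scale /= mulr1.
have := is_deriveB (is_derive_comp h (is_derive1_sqrt (arg_gt0 s)))
  (is_derive_cst (d ^+ 2) s 1).
rewrite subr0 (_ : _ * (s + s) = dsmooth_abs d s)//.
by rewrite /dsmooth_abs; field; rewrite gt_eqF// sqrtr_gt0.
Qed.

Lemma continuous_dsmooth_abs : continuous (dsmooth_abs d).
Proof.
move=> s.
apply: (@continuousM _ _ (fun t : R => t) (fun t : R => (Num.sqrt (t ^+ 2 + (d ^+ 2) ^+ 2))^-1)).
  exact: cvg_id.
apply: continuousV; first by rewrite gt_eqF// sqrtr_gt0.
apply: (continuous_comp (f := fun t : R => t ^+ 2 + (d ^+ 2) ^+ 2)).
  by apply: continuousD; [exact: exprn_continuous|exact: cst_continuous].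
exact: sqrt_continuous.
Qed.

Let abs_le_sqrt (s : R) : `|s| <= Num.sqrt (s ^+ 2 + (d ^+ 2) ^+ 2).
Proof. by rewrite -sqrtr_sqr ler_wsqrtr// lerDl sqr_ge0. Qed.

Let sqr_le_sqrt (s : R) : d ^+ 2 <= Num.sqrt (s ^+ 2 + (d ^+ 2) ^+ 2).
Proof. by rewrite -[leLHS]ger0_norm ?sqr_ge0// -sqrtr_sqr ler_wsqrtr// lerDr sqr_ge0. Qed.

Lemma dsmooth_abs_le1 (s : R) : `|dsmooth_abs d s| <= 1.
Proof.
rewrite normrM normfV (gtr0_norm (x := Num.sqrt _)) ?sqrtr_gt0//.
by rewrite ler_pdivrMr ?sqrtr_gt0// mul1r.
Qed.

Lemma smooth_abs_ge0 (s : R) : 0 <= smooth_abs d s.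
Proof. by rewrite subr_ge0. Qed.

(** The gap is at most both d^2 and |s|, hence at most their geometric mean. Unlike the constant
    d^2, this error vanishes where [s] does, so with [s] replaced by [w] it remains compactly
    supported. *)
Lemma smooth_abs_approx (s : R) : `|s| <= smooth_abs d s + d * Num.sqrt `|s|.
Proof.
have := abs_le_sqrt s; have := sqr_le_sqrt s; rewrite /smooth_abs.
set r := Num.sqrt (_ + _); have := sqr_sqrtr (normr_ge0 s).
have := sqrtr_ge0 `|s|; set q := Num.sqrt `|s|.
rewrite !expr2 => q0 q2 dr sr; have [qd|/ltW qd] := leP d q.
  by move: (ler_wpM2l (ltW d0) qd); lra.
by move: (ler_wpM2r q0 qd); lra.
Qed.
End smooth_abs_theory.

Section weighted_hardy.
Context {R : realType} {n : nat}.
Context (k : nat) (sigma : nat -> R) (kn : (k <= n.+1)%N).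
Implicit Types (u w : 'rV[R]_n.+1 -> R) (x : 'rV[R]_n.+1).

(** The working class: C^1 functions supported at distance from the boundary. It is stable under C^1
    factors and under composition with C^1 functions fixing 0. *)
Definition admissible (M eps : R) u := [/\ 0 < eps, c1on u & hsupp M eps u].

Lemma admissible_c0on_cc M eps u f : admissible M eps u -> c0on f ->
  cc (fun x => f x * u x).
Proof.
move=> [e0 [cu _ _] hu] cf; apply: (c0on_cc (M := M) e0 (c0onM cf cu)).
exact: (hsuppMr _ hu).
Qed.

Lemma admissibleM M eps u f : admissible M eps u -> c1on f ->
  admissible M eps (fun x => f x * u x).
Proof. by move=> [e0 cu hu] cf; split; [exact: e0|exact: c1onM|exact: hsuppMr]. Qed.

Lemma admissible_c1c M eps u : admissible M eps u -> c1c u.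
Proof. by move=> [e0 cu hu]; exact: (c1on_c1c e0 cu hu). Qed.

Lemma hsupp_sum_partial M eps u : hsupp M eps u -> hsupp M eps (sum_partial u).
Proof.
move=> hu x hx; rewrite /sum_partial big1// => i _.
by rewrite (hsupp_partial i hu hx) normr0.
Qed.

Lemma admissible_sum_partial_cc M eps u f : admissible M eps u -> c0on f ->
  cc (fun x => f x * sum_partial u x).
Proof.
move=> [e0 [cu _ cp] hu] cf; apply: (@c0on_cc _ _ M eps _ e0).
  apply: c0onM => //; apply: c0on_sum => i _.
  by apply: (c0on_comp (@norm_continuous _ _)); exact: cp.
exact/hsuppMr/hsupp_sum_partial.
Qed.

Let P l := @Pw R n k (shift_exp sigma l).
Let J l u := integral_Rn (fun x => P l x * u x).
Let G u := integral_Rn (fun x => Pw k sigma x * sum_partial u x).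

Let cP l : c1on (P l). Proof. exact: c1on_Pw. Qed.
Let cP0 l : c0on (P l). Proof. by have [] := cP l. Qed.

(** Exchanging the sums, the coordinates with i < l and i < j add up to |X_min(l,j)|^2 / |X_j|^2.
    This ratio is 1 for j up to l, where the shifted exponents sum to s_1 + ... + s_l - 1; the terms
    j > l keep the ratio. *)
Lemma sum_normsq_ratio l x : (0 < l <= k)%N -> 0 < x 0 ord0 ->
  \sum_(i < n.+1 | (i < l)%N)
    (1 + x 0 i ^+ 2 * \sum_(1 <= j < k.+1 | (i < j)%N) shift_exp sigma l j / normsq j x) =
  \sum_(1 <= j < l.+1) sigma j + l%:R - 1 +
  \sum_(l.+1 <= j < k.+1) sigma j * (normsq l x / normsq j x).
Proof.
move=> /andP[l0 lk] x0; rewrite big_split /=.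
have -> : \sum_(i < n.+1 | (i < l)%N) 1 = l%:R :> R.
  rewrite -(big_ord_widen n.+1 (fun=> 1)) ?(leq_trans lk)//.
  by rewrite sumr_const card_ord.
have -> : \sum_(i < n.+1 | (i < l)%N)
    (x 0 i ^+ 2 * \sum_(1 <= j < k.+1 | (i < j)%N) shift_exp sigma l j / normsq j x) =
  \sum_(1 <= j < k.+1) shift_exp sigma l j * (normsq (minn l j) x / normsq j x).
  under eq_bigr do rewrite big_distrr /=.
  rewrite (exchange_big_dep xpredT)//=; apply: eq_bigr => j _.
  rewrite /normsq big_distrl big_distrr /=.
  apply: eq_big => i; first by rewrite leq_min.
  by move=> _; ring.
rewrite (@big_cat_nat _ _ _ l.+1) //=.
have -> : \sum_(1 <= j < l.+1) shift_exp sigma l j * (normsq (minn l j) x / normsq j x) =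
    \sum_(1 <= j < l.+1) sigma j - 1.
  transitivity (\sum_(1 <= j < l.+1) (sigma j - (j == l)%:R)).
    apply: eq_big_nat => j /andP[j1 jl]; rewrite ltnS in jl.
    by rewrite (minn_idPr jl) divff ?mulr1// gt_eqF// normsq_gt0.
  rewrite sumrB; congr (_ - _).
  transitivity (\sum_(1 <= j < l.+1 | j == l) (1 : R)).
    by rewrite [RHS]big_mkcond; apply: eq_bigr => j _; case: eqP.
  by rewrite big_nat1_eq l0 ltnSn.
have -> : \sum_(l.+1 <= j < k.+1) shift_exp sigma l j * (normsq (minn l j) x / normsq j x) =
    \sum_(l.+1 <= j < k.+1) sigma j * (normsq l x / normsq j x).
  apply: eq_big_nat => j /andP[lj jk].
  by rewrite /shift_exp (gtn_eqF lj) subr0 (minn_idPl (ltnW lj)).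
by ring.
Qed.

(* The divergence of [u] times the vector field [W X_l / |X_l|], where [W] is
   the weight and [X_l = (x_1, .., x_l)]. *)
Let div_field l u x : R :=
  \sum_(i < n.+1 | (i < l)%N) partial i (fun y : 'rV[R]_n.+1 => y 0 i * (P l y * u y)) x.

Lemma div_fieldE l u x : (0 < l <= k)%N -> c1on u -> 0 < x 0 ord0 ->
  div_field l u x =
  P l x * u x * (\sum_(1 <= j < l.+1) sigma j + l%:R - 1 +
     \sum_(l.+1 <= j < k.+1) sigma j * (normsq l x / normsq j x)) +
  P l x * \sum_(i < n.+1 | (i < l)%N) x 0 i * partial i u x.
Proof.
move=> lk cu x0; rewrite -sum_normsq_ratio// !big_distrr /= -big_split /=.
apply: eq_bigr => i il.
rewrite (partialM _ (c1on_coord i) (c1onM (cP l) cu))// partial_coord eqxx.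
rewrite (partialM _ (cP l) cu)//.
rewrite (partial_Pw k (shift_exp sigma l) i x0 : partial i (P l) x = P l x * _).
by rewrite mulr1n; move: (P l x) (\sum_(1 <= j < k.+1 | _) _) => p T; ring.
Qed.

Lemma integral_div_field l u M eps : admissible M eps u ->
  cc (div_field l u) /\ integral_Rn (div_field l u) = 0.
Proof.
move=> au.
have cF i : c1c (fun y : 'rV[R]_n.+1 => y 0 i * (P l y * u y)).
  by apply: (@admissible_c1c M eps); apply: admissibleM (c1on_coord i); exact: admissibleM.
split; first by apply: cc_sum => i _; exact: cc_partial.
rewrite /div_field integral_Rn_sum; last by move=> i _; exact: cc_partial.
by rewrite big1// => i _; exact: integral_partial_eq0.
Qed.

(** The left side is W |X_l| / |X_j|^2 and the right side W / |X_j|. *)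
Lemma P_normsq_ratio_le l j x : (0 < l <= j)%N -> (j <= k)%N -> 0 < x 0 ord0 ->
  P l x * (normsq l x / normsq j x) <= P j x.
Proof.
move=> /andP[l0 lj] jk x0.
have Nl := normX_gt0 l0 x0; have Nj := normX_gt0 (leq_trans l0 lj) x0.
have El := @Pw_shift _ _ k sigma l x _ x0.
have Ej := @Pw_shift _ _ k sigma j x _ x0.
rewrite -!normX_sqr.
have -> : P l x * (normX l x ^+ 2 / normX j x ^+ 2) =
  Pw k sigma x * (normX l x / normX j x ^+ 2).
  by rewrite -El ?l0 ?(leq_trans lj)// -/(P l x) expr2; ring.
have -> : P j x = Pw k sigma x / normX j x.
  by rewrite -Ej ?(leq_trans l0 lj)// mulfK// gt_eqF.
rewrite ler_pM2l ?Pw_gt0// ler_pdivrMr ?exprn_gt0// expr2 mulrA mulVf ?gt_eqF// mul1r.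
exact: normX_le.
Qed.

Lemma P_coord_le l (i : 'I_n.+1) x : (i < l <= k)%N -> 0 < x 0 ord0 ->
  `|x 0 i| * P l x <= Pw k sigma x.
Proof.
move=> /andP[il lk] x0.
rewrite -(@Pw_shift _ _ k sigma l x _ x0) ?(leq_ltn_trans _ il)//.
by rewrite mulrC ler_pM2l ?Pw_gt0//; exact: coord_le_normX.
Qed.

(** Multiplying the divergence by the sign of its leading coefficient makes the absolute value
    [cconst sigma l] appear; the other terms are moved across by absolute values. *)
Lemma hardy_pointwise l u x : (0 < l <= k)%N -> c1on u -> 0 < x 0 ord0 -> 0 <= u x ->
  cconst sigma l * (P l x * u x) <=
  Num.sg (\sum_(1 <= j < l.+1) sigma j + l%:R - 1) * div_field l u x +
  \sum_(l.+1 <= j < k.+1) `|sigma j| * (P j x * u x) +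
  Pw k sigma x * sum_partial u x.
Proof.
move=> lk cu x0 u0; have /andP[l0 lek] := lk; rewrite /cconst.
set s := _ + _ - 1.
have sg1 : `|Num.sg s| <= 1 by rewrite normr_sg; case: (s != 0).
rewrite (div_fieldE lk cu x0) -/s.
set A := \sum_(l.+1 <= j < k.+1) sigma j * _.
set B := \sum_(i < n.+1 | _) _.
have hA : `|P l x * u x * A| <= \sum_(l.+1 <= j < k.+1) `|sigma j| * (P j x * u x).
  rewrite /A big_distrr /=; apply: le_trans (ler_norm_sum _ _ _) _.
  apply: ler_sum_nat => j /andP[lj jk].
  have -> : P l x * u x * (sigma j * (normsq l x / normsq j x)) =
    sigma j * (P l x * (normsq l x / normsq j x) * u x) by ring.
  rewrite normrM; apply: ler_wpM2l => //.
  rewrite ger0_norm; last first.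
    by rewrite mulr_ge0// mulr_ge0 ?ltW ?Pw_gt0// divr_gt0// normsq_gt0// (leq_trans _ lj).
  by apply: ler_wpM2r => //; apply: P_normsq_ratio_le; rewrite ?l0//= ltnW.
have hB : `|P l x * B| <= Pw k sigma x * sum_partial u x.
  rewrite /B /sum_partial !big_distrr /=; apply: le_trans (ler_norm_sum _ _ _) _.
  rewrite big_mkcond; apply: ler_sum => i _; case: ifP => il; last first.
    by rewrite mulr_ge0// ltW// Pw_gt0.
  rewrite !normrM (gtr0_norm (Pw_gt0 _ _ _)) mulrA; apply: ler_wpM2r => //.
  by rewrite mulrC; apply: P_coord_le; rewrite ?il.
have nA := le_trans (ler_norm _) hA.
have bound (y : R) : - `|y| <= Num.sg s * y.
  have : `|Num.sg s * y| <= `|y| by rewrite normrM ler_piMl.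
  by rewrite ler_norml => /andP[].
have -> : `|s| * (P l x * u x) = Num.sg s * (P l x * u x * s).
  by rewrite normrEsg; ring.
have -> : Num.sg s * (P l x * u x * (s + A) + P l x * B) =
   Num.sg s * (P l x * u x * s) + Num.sg s * (P l x * u x * A) + Num.sg s * (P l x * B) by ring.
have := bound (P l x * u x * A); have := bound (P l x * B).
move: hA hB; lra.
Qed.

Lemma hardy_step l u M eps : (0 < l <= k)%N -> admissible M eps u -> (forall x, 0 <= u x) ->
  cconst sigma l * J l u <= \sum_(l.+1 <= j < k.+1) `|sigma j| * J j u + G u.
Proof.
move=> lk au u0; have [e0 cu hu] := au.
have [cD ID] := integral_div_field l au.
have cJ j : cc (fun x => P j x * u x) by apply: (admissible_c0on_cc au); exact: cP0.
have cG : cc (fun x => Pw k sigma x * sum_partial u x).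
  by apply: (admissible_sum_partial_cc au); exact: c0on_Pw.
pose s := \sum_(1 <= j < l.+1) sigma j + l%:R - 1.
have cs : cc (fun x => \sum_(l.+1 <= j < k.+1) `|sigma j| * (P j x * u x)).
  by apply: cc_sum => j _; exact: ccZ.
have cD1 : cc (fun x => Num.sg s * div_field l u x) by exact: ccZ.
rewrite /J /G -integral_RnZ//.
have -> : \sum_(l.+1 <= j < k.+1) `|sigma j| * integral_Rn (fun x => P j x * u x) =
  integral_Rn (fun x => \sum_(l.+1 <= j < k.+1) `|sigma j| * (P j x * u x)).
  rewrite integral_Rn_sum; last by move=> j _; exact: ccZ.
  by apply: eq_bigr => j _; rewrite integral_RnZ.
have I0 : integral_Rn (fun x => Num.sg s * div_field l u x) = 0.
  by rewrite integral_RnZ// ID mulr0.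
rewrite -[leRHS]add0r -[X in X + _]I0 addrA -integral_RnD// -integral_RnD//; last exact: ccD.
apply: le_integral_Rn; first exact: ccZ.
  by apply: ccD => //; exact: ccD.
move=> x; have [x0|x0] := ltP 0 (x 0 ord0); first exact: hardy_pointwise.
(* Off the half-space every term vanishes by the support condition, so the pointwise inequality
   holds everywhere. *)
have hx : M < `|x| \/ x 0 ord0 < eps by right; exact: le_lt_trans e0.
rewrite (hsupp_sum_partial hu hx) (hu _ hx) !mulr0.
rewrite big1; last by move=> j _; rewrite !mulr0.
rewrite /div_field big1 ?mulr0 ?addr0// => i _.
apply: (@hsupp_partial _ _ M eps) hx.
by apply: hsuppMr; exact: hsuppMr.
Qed.

Context (hc : forall l : nat, (1 <= l <= k)%N -> sigma l != 0 -> cconst sigma l != 0).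

Lemma G_ge0 M eps u : admissible M eps u -> 0 <= G u.
Proof.
move=> au; apply: integral_Rn_ge0.
  by apply: (admissible_sum_partial_cc au); exact: c0on_Pw.
by move=> x; rewrite mulr_ge0 ?sum_partial_ge0// ltW ?Pw_gt0.
Qed.

(* Downward induction on [j]: [hardy_step] controls the term of index [l] by
   those of larger index. *)
Lemma hardy_nonneg : exists2 K : R, 0 <= K & forall u M eps j,
  admissible M eps u -> (forall x, 0 <= u x) -> (1 <= j <= k)%N ->
  `|sigma j| * J j u <= K * G u.
Proof.
(* [m] counts the largest indices already treated, those with [k < j + m]; taking m = k covers all
   of them. *)
suff : forall m, exists2 K : R, 0 <= K & forall u M eps j,
    admissible M eps u -> (forall x, 0 <= u x) -> (1 <= j <= k)%N -> (k < j + m)%N ->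
    `|sigma j| * J j u <= K * G u.
  move=> /(_ k)[K K0 hK]; exists K => // u M eps j au u0 /[dup] jk /andP[j1 _].
  by apply: (hK u M eps) => //; rewrite -addn1 addnC leq_add2r.
elim=> [|m [K K0 hK]].
  exists 0 => // u M eps j _ _ /andP[_ jk]; by rewrite addn0 ltnNge jk.
pose l := (k - m)%N.
(* At most [k] later terms, each bounded by [K * G u], plus [G u] itself, are divided by
   [cconst sigma l]. If [sigma l] is 0 the added term is 0 and no division matters. *)
pose K' := K + `|sigma l| / cconst sigma l * (k%:R * K + 1).
have c0 : 0 <= cconst sigma l by exact: normr_ge0.
have d0 : 0 <= `|sigma l| / cconst sigma l * (k%:R * K + 1).
  by rewrite mulr_ge0 ?divr_ge0// addr_ge0// mulr_ge0.
exists K'; first by rewrite addr_ge0.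
move=> u M eps j au u0 jk; rewrite addnS ltnS leq_eqVlt => /predU1P[kjm|kjm]; last first.
  apply: le_trans (hK u M eps j au u0 jk kjm) _.
  by apply: ler_wpM2r; [exact: G_ge0 au|rewrite lerDl].
have jl : j = l by rewrite /l kjm addnK.
subst j; have G0 := G_ge0 au.
have [s0|s0] := eqVneq (sigma l) 0.
  by rewrite s0 normr0 mul0r mulr_ge0// addr_ge0.
have cn := hc jk s0; have cpos : 0 < cconst sigma l by rewrite lt_neqAle eq_sym cn.
have := hardy_step jk au u0.
have sumle : \sum_(l.+1 <= j < k.+1) `|sigma j| * J j u <= k%:R * (K * G u).
  have : \sum_(l.+1 <= j < k.+1) `|sigma j| * J j u <= \sum_(l.+1 <= j < k.+1) K * G u.
    apply: ler_sum_nat => j /andP[lj jk'].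
    apply: (hK u M eps j au u0); first by rewrite (leq_trans _ lj).
    by rewrite kjm ltn_add2r.
  move=> /le_trans; apply; rewrite sumr_const_nat -[leLHS]mulr_natl.
  by apply: ler_wpM2r; [rewrite mulr_ge0|rewrite ler_nat subSS leq_subr].
move=> step.
have : J l u <= (cconst sigma l)^-1 * ((k%:R * K + 1) * G u).
  by rewrite mulrC ler_pdivlMr// mulrC; move: step sumle; lra.
move=> /(ler_wpM2l (normr_ge0 (sigma l))) /le_trans; apply.
by rewrite /K' [in leRHS]mulrDl !mulrA lerDr mulr_ge0.
Qed.

(** The nonnegative case is applied to [smooth_abs d] of [w], and [d] tends to 0 with [K] fixed. *)
Lemma hardy : exists2 K : R, 0 <= K & forall w M eps j,
  admissible M eps w -> (1 <= j <= k)%N ->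
  `|sigma j| * integral_Rn (fun x => P j x * `|w x|) <= K * G w.
Proof.
have [K K0 hK] := hardy_nonneg; exists K => // w M eps j aw jk.
have [e0 cw hw] := aw; have [cw0 _ cwp] := cw.
have cPnorm (th : R -> R) : continuous th -> th 0 = 0 -> cc (fun x => P j x * th (w x)).
  move=> cth th0; apply: (@c0on_cc _ _ M eps _ e0).
    by apply: c0onM; [exact: cP0|exact: c0on_comp].
  by move=> x hx; rewrite (hw _ hx) th0 mulr0.
have csq : continuous (fun s : R => Num.sqrt `|s|).
  by move=> s; apply: continuous_comp; [exact: norm_continuous|exact: sqrt_continuous].
set B := integral_Rn (fun x => P j x * Num.sqrt `|w x|).
have cB : cc (fun x => P j x * Num.sqrt `|w x|).
  by apply: (cPnorm (fun s => Num.sqrt `|s|)) => //; rewrite normr0 sqrtr0.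
have B0 : 0 <= B.
  by apply: integral_Rn_ge0 => // x; rewrite mulr_ge0 ?sqrtr_ge0// ltW// Pw_gt0.
apply/ler_addgt0Pr => e e_gt0.
have sB0 : 0 < `|sigma j| * B + 1 by rewrite ltr_wpDl// mulr_ge0.
(* The approximation error is [d * B] with B the integral of P_j sqrt|w|, so this [d] keeps |s_j|
   times the error below [e]. *)
pose d := e / (`|sigma j| * B + 1).
have d0 : 0 < d by rewrite divr_gt0.
pose u x := smooth_abs d (w x).
have cu : c1on u by exact: (c1on_comp (is_derive_smooth_abs d0) (continuous_dsmooth_abs d0) cw).
have au : admissible M eps u.
  by split => // x hx; rewrite /u (hw _ hx) smooth_abs0.
have u0 x : 0 <= u x by exact: smooth_abs_ge0.
have := hK u M eps j au u0 jk.
have cG v : admissible M eps v -> cc (fun x => Pw k sigma x * sum_partial v x).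
  by move=> av; apply: (admissible_sum_partial_cc av); exact: c0on_Pw.
(* The derivative of [smooth_abs d] is at most 1 in absolute value, so the gradient term does not
   grow. *)
have Gle : G u <= G w.
  apply: le_integral_Rn; [exact: cG|exact: cG|] => x.
  apply: ler_wpM2l; first by rewrite ltW// Pw_gt0.
  have [x0|x0] := ltP 0 (x 0 ord0); last first.
    have hx : M < `|x| \/ x 0 ord0 < eps by right; exact: le_lt_trans e0.
    have [_ _ hu] := au.
    by rewrite (hsupp_sum_partial hu hx) (hsupp_sum_partial hw hx).
  apply: ler_sum => i _; rewrite (partial_comp i (is_derive_smooth_abs d0) cw x0) normrM.
  by rewrite ler_piMl// dsmooth_abs_le1.
have Jle : integral_Rn (fun x => P j x * `|w x|) <= J j u + d * B.
  have cJ : cc (fun x => P j x * u x) by apply: (admissible_c0on_cc au); exact: cP0.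
  rewrite -integral_RnZ// -integral_RnD//; last exact: ccZ.
  apply: le_integral_Rn; first by apply: (cPnorm Num.norm); [exact: norm_continuous|exact: normr0].
    by apply: ccD => //; exact: ccZ.
  move=> x; rewrite [d * _]mulrCA -mulrDr ler_wpM2l ?smooth_abs_approx// ltW// Pw_gt0//.
move=> hJ.
have h1 := ler_wpM2l (normr_ge0 (sigma j)) Jle.
have h2 := ler_wpM2l K0 Gle.
have h3 : d * (`|sigma j| * B + 1) = e by rewrite /d divfK// gt_eqF.
have h4 : `|sigma j| * (d * B) = e - d by rewrite -h3; ring.
apply: le_trans h1 _; rewrite mulrDr h4.
apply: lerD; first exact: le_trans hJ h2.
by rewrite lerBlDr lerDl ltW.
Qed.

End weighted_hardy.
(** * The weighted Sobolev inequalities *)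

Section weighted_sobolev.
Context {R : realType}.

Lemma abs_partial_le_grad_norm {n : nat} (w : 'rV[R]_n -> R) (i : 'I_n) x :
  `|partial i w x| <= grad_norm w x.
Proof.
rewrite -sqrtr_sqr; apply: ler_wsqrtr.
by rewrite (bigD1 i)//= lerDl sumr_ge0// => l _; exact: sqr_ge0.
Qed.

Lemma grad_norm_ge0 {n : nat} (w : 'rV[R]_n -> R) x : 0 <= grad_norm w x.
Proof. exact: sqrtr_ge0. Qed.

Lemma c0on_grad_norm {n : nat} (w : 'rV[R]_n.+1 -> R) : c1on w -> c0on (grad_norm w).
Proof.
move=> [_ _ cp]; apply: (c0on_comp (th := Num.sqrt)); first exact: sqrt_continuous.
apply: c0on_sum => i _.
by apply: (c0on_comp (th := fun s => s ^+ 2)); [exact: exprn_continuous|exact: cp].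
Qed.

Lemma hsupp_grad_norm {n : nat} (w : 'rV[R]_n.+1 -> R) M eps :
  hsupp M eps w -> hsupp M eps (grad_norm w).
Proof.
move=> hw x hx; rewrite /grad_norm big1 ?sqrtr0// => i _.
by rewrite (hsupp_partial i hw hx) expr0n.
Qed.

Lemma Pw_coord_le {n : nat} k (sigma : nat -> R) j (i : 'I_n.+1) (x : 'rV[R]_n.+1) :
  (i < j <= k)%N -> 0 < x 0 ord0 ->
  Pw k sigma x * (`|x 0 i| / normsq j x) <= Pw k (shift_exp sigma j) x.
Proof.
move=> /andP[ij jk] x0; have j0 := leq_ltn_trans (leq0n i) ij.
rewrite mulrA ler_pdivrMr ?normsq_gt0//.
rewrite -(@Pw_shift _ _ k sigma j x _ x0) ?j0// -mulrA ler_pM2l ?Pw_gt0//.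
by rewrite -normX_sqr expr2 ler_pM2l ?normX_gt0// coord_le_normX.
Qed.

(** Product rule, with |x_i| / |X_j|^2 at most 1 / |X_j|. The same bound serves for each direction,
    whence the factor [n.+1]. *)
Lemma sum_partial_weighted_le {n : nat} k (sigma : nat -> R) (w : 'rV[R]_n.+1 -> R) (x : 'rV[R]_n.+1) :
  c1on w -> 0 < x 0 ord0 ->
  sum_partial (fun y => Pw k sigma y * w y) x <=
  Pw k sigma x * sum_partial w x +
  n.+1%:R * \sum_(1 <= j < k.+1) `|sigma j| * (Pw k (shift_exp sigma j) x * `|w x|).
Proof.
move=> cw x0.
set S := \sum_(1 <= j < k.+1) _.
have -> : n.+1%:R * S = \sum_(i < n.+1) S by rewrite sumr_const card_ord mulr_natl.
rewrite /sum_partial big_distrr -big_split; apply: ler_sum => i _ /=.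
rewrite (partialM i (c1on_Pw k sigma) cw x0) partial_Pw//.
apply: le_trans (ler_normD _ _) _; rewrite normrM (gtr0_norm (Pw_gt0 _ _ _)) lerD2l.
have -> : w x * (Pw k sigma x * (x 0 i * \sum_(1 <= j < k.+1 | (i < j)%N) sigma j / normsq j x)) =
  \sum_(1 <= j < k.+1 | (i < j)%N) sigma j * (Pw k sigma x * (x 0 i / normsq j x) * w x).
  by rewrite !big_distrr /=; apply: eq_bigr => j _; ring.
apply: le_trans (ler_norm_sum _ _ _) _.
rewrite /S big_mkcond; apply: ler_sum_nat => j /andP[j1 jk]; rewrite ltnS in jk.
have Pj := Pw_gt0 k (shift_exp sigma j) x.
case: ifP => ij; last by rewrite mulr_ge0// mulr_ge0// ltW.
rewrite !normrM (gtr0_norm (Pw_gt0 _ _ _)); apply: ler_wpM2l => //.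
apply: ler_wpM2r => //; rewrite normfV (gtr0_norm (normsq_gt0 j1 x0)).
by apply: Pw_coord_le; rewrite ?ij.
Qed.

Lemma powR_inv_le (L S r : R) : 0 < r -> 0 <= L -> 0 <= S ->
  L <= powR S r -> powR L r^-1 <= S.
Proof.
move=> r0 L0 S0 LS; have : powR L r^-1 <= powR (powR S r) r^-1.
  by apply: ge0_ler_powR; rewrite ?nnegrE ?powR_ge0// invr_ge0 ltW.
by rewrite -powRrM divff ?gt_eqF// powRr1.
Qed.

Lemma weighted_sobolev_L1 (m k : nat) (sigma : nat -> R) : (k <= m.+2)%N ->
  (forall l : nat, (1 <= l <= k)%N -> sigma l != 0 -> cconst sigma l != 0) ->
  exists2 C : R, 0 < C & forall (w : 'rV[R]_m.+2 -> R) M eps, admissible M eps w ->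
    C * powR (integral_Rn (fun x => powR (Pw k sigma x * `|w x|) (gns_exp m))) (gns_exp m)^-1 <=
    integral_Rn (fun x => Pw k sigma x * grad_norm w x).
Proof.
move=> km hc; have [K K0 hK] := hardy km hc.
(* The 1 comes from W times the derivatives of [w]; each of the m+2 directions adds [k] Hardy terms
   of size at most [K * G]. The further factor m+2 in the final constant passes from the sum of
   partial derivatives to the gradient norm. *)
pose C1 : R := 1 + m.+2%:R * (k%:R * K).
have C10 : 0 < C1 by rewrite ltr_pwDl// mulr_ge0// mulr_ge0.
have m0 : 0 < m.+2%:R :> R by [].
exists (C1 * m.+2%:R)^-1; first by rewrite invr_gt0 mulr_gt0.
move=> w M eps aw; have [e0 cw hw] := aw; have [cw0 _ cwp] := cw.
have av : admissible M eps (fun y => Pw k sigma y * w y).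
  by apply: (admissibleM aw); exact: c1on_Pw.
have cv := admissible_c1c av; have [ccv _ _] := cv.
have cP := @c0on_Pw R m.+1 k sigma.
have cG : cc (fun x => Pw k sigma x * sum_partial w x) by exact: (admissible_sum_partial_cc aw).
have cg : cc (fun x => Pw k sigma x * grad_norm w x).
  apply: (@c0on_cc _ _ M eps _ e0); first by apply: c0onM => //; exact: c0on_grad_norm.
  exact/hsuppMr/hsupp_grad_norm.
have cH j : cc (fun x => Pw k (shift_exp sigma j) x * `|w x|).
  apply: (@c0on_cc _ _ M eps _ e0).
    by apply: c0onM; [exact: c0on_Pw|apply: (c0on_comp (@norm_continuous _ _))].
  by move=> x hx; rewrite (hw _ hx) normr0 mulr0.
set G := integral_Rn (fun x => Pw k sigma x * sum_partial w x).
set D := integral_Rn (fun x => Pw k sigma x * grad_norm w x).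
have GD : G <= m.+2%:R * D.
  rewrite -(integral_RnZ _ cg); apply: le_integral_Rn; [exact: cG|exact: ccZ|].
  move=> x; rewrite mulrCA; apply: ler_wpM2l; first by rewrite ltW// Pw_gt0.
  have -> : m.+2%:R * grad_norm w x = \sum_(i < m.+2) grad_norm w x.
    by rewrite sumr_const card_ord mulr_natl.
  by apply: ler_sum => i _; exact: abs_partial_le_grad_norm.
have sv : integral_Rn (sum_partial (fun y => Pw k sigma y * w y)) <= C1 * G.
  have cs : cc (fun x => \sum_(1 <= j < k.+1) `|sigma j| * (Pw k (shift_exp sigma j) x * `|w x|)).
    by apply: cc_sum => j _; exact: ccZ.
  apply: (@le_trans _ _ (integral_Rn (fun x => Pw k sigma x * sum_partial w x +
    m.+2%:R * \sum_(1 <= j < k.+1) `|sigma j| * (Pw k (shift_exp sigma j) x * `|w x|)))).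
    apply: le_integral_Rn; first exact: cc_sum_partial.
      exact: (ccD cG (ccZ _ cs)).
    move=> x; have [x0|x0] := ltP 0 (x 0 ord0); first exact: sum_partial_weighted_le.
    have hx : M < `|x| \/ x 0 ord0 < eps by right; exact: le_lt_trans e0.
    have [_ _ hv] := av.
    rewrite (hsupp_sum_partial hv hx) (hsupp_sum_partial hw hx) mulr0 add0r.
    by rewrite mulr_ge0// sumr_ge0// => j _; rewrite mulr_ge0// mulr_ge0// ltW// Pw_gt0.
  rewrite (integral_RnD cG (ccZ _ cs)).
  have -> : C1 * G = G + m.+2%:R * (k%:R * K * G) by rewrite /C1; ring.
  apply: lerD; first exact: lexx.
  rewrite (integral_RnZ _ cs) (ler_pM2l m0).
  rewrite integral_Rn_sum; last by move=> j _; exact: ccZ.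
  have -> : k%:R * K * G = \sum_(1 <= j < k.+1) K * G.
    by rewrite sumr_const_nat subn1 -[RHS]mulr_natl mulrA.
  apply: ler_sum_nat => j jk; rewrite (integral_RnZ _ (cH j)).
  exact: (hK w M eps j aw jk).
have := @gagliardo_nirenberg_sobolev R m _ cv.
set L := integral_Rn _; set S := integral_Rn _ => LS.
have -> : integral_Rn (fun x => powR (Pw k sigma x * `|w x|) (gns_exp m)) = L.
  by congr integral_Rn; apply/funext => x; rewrite normrM (gtr0_norm (Pw_gt0 _ _ _)).
have r0 := @gns_exp_gt0 R m.
have L0 : 0 <= L.
  by apply: integral_Rn_ge0; [exact: (cc_powR r0 ccv)|move=> x; exact: powR_ge0].
have S0 : 0 <= S.
  by apply: integral_Rn_ge0; [exact: cc_sum_partial|move=> x; exact: sum_partial_ge0].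
rewrite (ler_pdivrMl _ _ (mulr_gt0 C10 m0)) -mulrA.
apply: le_trans (powR_inv_le r0 L0 S0 LS) _; apply: le_trans sv _.
by rewrite (ler_pM2l C10); exact: GD.
Qed.

(** * Powers of the absolute value and the quadratic inequality *)

Lemma powR_abs2 (p s : R) : 2 < p ->
  powR `|s| p = s * (s * powR `|s| (p - 2)).
Proof.
move=> p2.
have p0 : 0 < p by lra.
have p1 : 0 < p - 1 by lra.
rewrite -(mulr_powRB1 (normr_ge0 s) p0) -(mulr_powRB1 (normr_ge0 s) p1).
rewrite (_ : p - 1 - 1 = p - 2); last by ring.
by rewrite !mulrA -normrM -expr2 ger0_norm ?sqr_ge0.
Qed.

Lemma sqr_powR_abs (s : R) : s * s = powR `|s| 2.
Proof. by rewrite powR_mulrn// real_normK ?num_real// expr2. Qed.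

Lemma continuous_mul_powR_abs (p : R) : 2 < p -> continuous (fun s : R => s * powR `|s| (p - 2)).
Proof.
move=> p2 s.
apply: (@continuousM _ _ (fun t : R => t) (fun t : R => powR `|t| (p - 2))).
  exact: cvg_id.
by apply: continuous_powR_norm; lra.
Qed.

Lemma continuous_dpowR_abs (p : R) : 2 < p ->
  continuous (fun s : R => p * (s * powR `|s| (p - 2))).
Proof.
move=> p2 s.
apply: (@continuousM _ _ (fun=> p) (fun t : R => t * powR `|t| (p - 2))).
  exact: cst_continuous.
exact: continuous_mul_powR_abs.
Qed.

Lemma norm_dpowR_abs (p s : R) : 2 < p ->
  `|p * (s * powR `|s| (p - 2))| = p * powR `|s| (p - 1).
Proof.
move=> p2; have p0 : 0 < p by lra.
have p1 : 0 < p - 1 by lra.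
rewrite !normrM (gtr0_norm p0) (ger0_norm (powR_ge0 _ _)); congr (_ * _).
rewrite -(mulr_powRB1 (normr_ge0 s) p1); congr (_ * powR _ _); ring.
Qed.

(** At 0 the difference quotient is h |h|^(p-2), which tends to 0. Elsewhere |t|^p = (t^2)^(p/2),
    which avoids differentiating the absolute value. *)
Lemma is_derive_powR_abs (p s : R) : 2 < p ->
  is_derive s 1 (fun t => powR `|t| p) (p * (s * powR `|s| (p - 2))).
Proof.
move=> p2; have [->|s0] := eqVneq s 0.
  rewrite mul0r mulr0.
  have e : (fun h : R => h^-1 *: (powR `|h *: (1 : R) + 0 : R| p - powR `|0 : R| p)) @ 0^' --> (0 : R).
    apply/(@cvgrPdist_lt _ _ _ (0^')) => eps eps0.
    have /(@cvgrPdist_lt _ _ _ (nbhs (0 : R)))/(_ _ eps0) := @continuous_mul_powR_abs p p2 0.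
    rewrite mul0r => h0.
    near=> h.
    have hn : h != 0 by near: h; exact: nbhs_dnbhs_neq.
    rewrite normr0 powR0 ?subr0; last by rewrite gt_eqF//; lra.
    rewrite addr0 [h *: 1]mulr1 powR_abs2// [_ *: _]mulKf//.
    near: h; exact: nbhs_dnbhs.
  by apply: DeriveDef; [exact: (cvgP _ e)|exact: (cvg_lim _ e)].
have E : (fun t : R => powR `|t| p) = (fun t : R => powR (t * t) (p / 2)).
  apply/funext => t; rewrite sqr_powR_abs -powRrM; congr powR; lra.
rewrite E.
have ss : 0 < s * s by rewrite -expr2 exprn_even_gt0.
have h := is_derive_comp (is_deriveM (is_derive_id s 1) (is_derive_id s 1))
   (is_derive1_powR (p / 2) ss).
have -> : p * (s * powR `|s| (p - 2)) = p / 2 * powR (s * s) (p / 2 - 1) * (s *: 1 + s *: 1).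
  have -> : powR `|s| (p - 2) = powR (s * s) (p / 2 - 1).
    by rewrite sqr_powR_abs -powRrM; congr powR; lra.
  by rewrite /GRing.scale /= mulr1; field.
exact: h.
Unshelve. all: by end_near.
Qed.

Lemma grad_norm_powR {n : nat} (p : R) (w : 'rV[R]_n.+1 -> R) (x : 'rV[R]_n.+1) :
  2 < p -> c1on w -> 0 < x 0 ord0 ->
  grad_norm (fun y => powR `|w y| p) x = p * powR `|w x| (p - 1) * grad_norm w x.
Proof.
move=> p2 cw x0; rewrite -(norm_dpowR_abs _ p2).
rewrite /grad_norm -sqrtr_sqr -sqrtrM ?sqr_ge0//; congr Num.sqrt.
rewrite big_distrr /=; apply: eq_bigr => i _.
by rewrite (partial_comp i (fun s => is_derive_powR_abs s p2) cw x0) exprMn.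
Qed.

Lemma powR_split (a s t : R) : 0 < a -> s + t = 1 -> a = powR a s * powR a t.
Proof.
move=> a0 st; rewrite -powRD; last by rewrite (gt_eqF a0) implybT.
by rewrite st powRr1// ltW.
Qed.

Lemma Pw_powR {n : nat} k (a : nat -> R) c (x : 'rV[R]_n.+1) :
  powR (Pw k a x) c = Pw k (fun j => a j * c) x.
Proof.
rewrite /powR gt_eqF ?Pw_gt0// expRK /Pw big_distrr /=; congr expR.
by apply: eq_bigr => j _; ring.
Qed.

Lemma cauchy_schwarz_integral_Rn {n : nat} (f g : 'rV[R]_n -> R) :
  cc f -> cc g -> (forall x, 0 <= f x) -> (forall x, 0 <= g x) ->
  integral_Rn (fun x => f x * g x) <=
  Num.sqrt (integral_Rn (fun x => powR (f x) 2)) * Num.sqrt (integral_Rn (fun x => powR (g x) 2)).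
Proof.
move=> cf cg f0 g0.
have h2 : (2^-1 + 2^-1 : R) = 1 by lra.
have sq (h : 'rV[R]_n -> R) : cc h -> (forall x, 0 <= h x) ->
    integral_Rn (fun x => powR (h x) 2) <= powR (Num.sqrt (integral_Rn (fun x => powR (h x) 2))) 2.
  move=> ch h0; rewrite powR_mulrn ?sqrtr_ge0// sqr_sqrtr//.
  have -> : (fun x => powR (h x) 2) = (fun x => powR `|h x| 2).
    by apply/funext => x; rewrite ger0_norm.
  by apply: integral_Rn_ge0; [exact: cc_powR|move=> x; exact: powR_ge0].
exact: (hoelder_integral_Rn (ltr0Sn R 1) (ltr0Sn R 1) h2 cf cg f0 g0 (sqrtr_ge0 _) (sqrtr_ge0 _)
  (sq f cf f0) (sq g cg g0)).
Qed.

(** Since (N-1)/N = (N-2)/(2N) + 1/2, a factor sqrt A cancels from both sides; squaring what remains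
    gives the claim. Cancelling needs A nonzero, so A = 0 is separate. *)
Lemma absorb_powR (N C p A B : R) : 3 <= N -> 0 < C -> 0 < p -> 0 <= A -> 0 <= B ->
  C * powR A ((N - 1) / N) <= p * (Num.sqrt A * Num.sqrt B) ->
  (C / p) ^+ 2 * powR A ((N - 2) / N) <= B.
Proof.
move=> N3 C0 p0 A0 B0 CA.
have N0 : 0 < N by lra.
have N2 : 0 < N - 2 by lra.
have [A_eq0|An0] := eqVneq A 0.
  by rewrite A_eq0 powR0 ?mulr0// gt_eqF// divr_gt0.
have Apos : 0 < A by rewrite lt_neqAle eq_sym An0.
pose X := powR A ((N - 2) / (2 * N)).
have AX : powR A ((N - 1) / N) = X * Num.sqrt A.
  rewrite -powR12_sqrt// /X -powRD; last by rewrite An0 implybT.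
  by congr powR; field; rewrite gt_eqF.
have XX : powR A ((N - 2) / N) = X ^+ 2.
  by rewrite -powR_mulrn ?powR_ge0// /X -powRrM; congr powR; field; rewrite gt_eqF.
have X0 : 0 <= X by exact: powR_ge0.
have sA : 0 < Num.sqrt A by rewrite sqrtr_gt0.
have CX : C / p * X <= Num.sqrt B.
  rewrite mulrAC ler_pdivrMr// -(ler_pM2r sA) -mulrA -AX.
  by apply: le_trans CA _; rewrite le_eqVlt; apply/orP; left; apply/eqP; ring.
rewrite XX -exprMn -(sqr_sqrtr B0) ler_sqr ?nnegrE ?sqrtr_ge0//.
by rewrite mulr_ge0// divr_ge0// ltW.
Qed.

(* The L^1 inequality is applied to |w|^p with p = 2 (N - 1) / (N - 2). *)
Lemma weighted_sobolev_L2 (m k : nat) (sigma : nat -> R) : (k <= m.+3)%N ->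
  (forall l : nat, (1 <= l <= k)%N -> sigma l != 0 -> cconst sigma l != 0) ->
  let N : R := m.+3%:R in
  exists2 C : R, 0 < C & forall (w : 'rV[R]_m.+3 -> R) M eps, admissible M eps w ->
    C * powR (integral_Rn (fun x => powR (Pw k (fun j => sigma j * ((N - 2) / (2 * (N - 1)))) x * `|w x|)
                 (2 * N / (N - 2)))) ((N - 2) / N) <=
    integral_Rn (fun x => Pw k (fun j => sigma j * ((N - 2) / (N - 1))) x * grad_norm w x ^+ 2).
Proof.
move=> km hc N; have [C C0 hC] := weighted_sobolev_L1 km hc.
have N3 : 3 <= N by rewrite /N ler_nat.
have N0 : 0 < N by lra.
have N1 : 0 < N - 1 by lra.
have N2 : 0 < N - 2 by lra.
have rE : gns_exp m.+1 = N / (N - 1).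
  rewrite /gns_exp (_ : m.+2%:R = N - 1); last by rewrite /N -[in RHS]natr1 addrK.
  by field; rewrite gt_eqF.
have [p pE] : exists p : R, p = 2 * (N - 1) / (N - 2) by eexists.
have p2 : 2 < p by rewrite pE ltr_pdivlMr//; lra.
have p0 : 0 < p by lra.
exists ((C / p) ^+ 2); first by rewrite exprn_gt0// divr_gt0.
move=> w M eps aw; have [e0 cw hw] := aw; have [cw0 _ cwp] := cw.
set Phi := fun x => powR (_ * `|w x|) _.
set A := integral_Rn Phi.
set B := integral_Rn _.
pose u x := powR `|w x| p.
have au : admissible M eps u.
  split; first exact: e0.
    apply: (c1on_comp (fun s => is_derive_powR_abs s p2) _ cw).
    exact: continuous_dpowR_abs.
  by move=> x hx; rewrite /u (hw _ hx) normr0 powR0// gt_eqF.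
(* The gradient of |w|^p gives the integrand p W |w|^(p-1) |grad w| with p - 1 = N/(N-2). The weight
   W is split with exponents adding up to 1 so that f^2 is the integrand of [A] and g^2 that of
   [B]. *)
pose f x := powR (Pw k sigma x) (N / (2 * (N - 1))) * powR `|w x| (N / (N - 2)).
pose g x := powR (Pw k sigma x) ((N - 2) / (2 * (N - 1))) * grad_norm w x.
have Nn2 : 0 < N / (N - 2) by rewrite divr_gt0.
have cpw (a : R) : c0on (fun x : 'rV[R]_m.+3 => powR (Pw k sigma x) a).
  have -> : (fun x : 'rV[R]_m.+3 => powR (Pw k sigma x) a) = Pw k (fun j => sigma j * a).
    by apply/funext => x; rewrite Pw_powR.
  exact: c0on_Pw.
have cf : cc f.
  apply: (@c0on_cc _ _ M eps _ e0).
    by apply: c0onM => //; apply: (c0on_comp (continuous_powR_norm Nn2)).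
  by move=> x hx; rewrite /f (hw _ hx) normr0 powR0 ?mulr0// gt_eqF.
have cg : cc g.
  apply: (@c0on_cc _ _ M eps _ e0); first by apply: c0onM => //; exact: c0on_grad_norm.
  exact/hsuppMr/hsupp_grad_norm.
have f0 x : 0 <= f x by rewrite mulr_ge0// powR_ge0.
have g0 x : 0 <= g x by rewrite mulr_ge0 ?powR_ge0// grad_norm_ge0.
have PhiE x : Phi x = powR (Pw k sigma x) (N / (N - 1)) * powR `|w x| (2 * N / (N - 2)).
  rewrite /Phi -Pw_powR powRM ?powR_ge0// -powRrM; congr (powR _ _ * _).
  by field; rewrite !gt_eqF.
have PhiF x : Phi x = powR (f x) 2.
  rewrite PhiE /f powRM ?powR_ge0// -!powRrM; congr (powR _ _ * powR _ _); field; rewrite ?gt_eqF//.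
have PhiU x : Phi x = powR (Pw k sigma x * `|u x|) (gns_exp m.+1).
  have -> : `|u x| = powR `|w x| p by rewrite ger0_norm// powR_ge0.
  rewrite PhiE rE powRM ?powR_ge0 ?(ltW (Pw_gt0 _ _ _))// -powRrM; congr (_ * powR _ _).
  by rewrite pE; field; rewrite !gt_eqF.
have gB x : powR (g x) 2 = Pw k (fun j => sigma j * ((N - 2) / (N - 1))) x * grad_norm w x ^+ 2.
  rewrite /g powRM ?powR_ge0 ?grad_norm_ge0// -powRrM -Pw_powR powR_mulrn ?grad_norm_ge0//.
  by congr (powR _ _ * _); field; rewrite gt_eqF.
have A0 : 0 <= A.
  rewrite /A; have -> : Phi = (fun x => powR `|f x| 2).
    by apply/funext => x; rewrite PhiF ger0_norm.
  by apply: integral_Rn_ge0; [exact: cc_powR|move=> x; exact: powR_ge0].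
have AE : integral_Rn (fun x => powR (f x) 2) = A.
  by congr integral_Rn; apply/funext => x; rewrite PhiF.
have BE : integral_Rn (fun x => powR (g x) 2) = B.
  by congr integral_Rn; apply/funext => x; exact: gB.
have B0 : 0 <= B.
  rewrite -BE; have -> : (fun x => powR (g x) 2) = (fun x => powR `|g x| 2).
    by apply/funext => x; rewrite ger0_norm// g0.
  apply: integral_Rn_ge0; last by move=> x; exact: powR_ge0.
  by apply: cc_powR; [exact: ltr0Sn|exact: cg].
have fg := cauchy_schwarz_integral_Rn cf cg f0 g0.
rewrite AE BE in fg.
have gradu : integral_Rn (fun x => Pw k sigma x * grad_norm u x) = p * integral_Rn (fun x => f x * g x).
  rewrite -(integral_RnZ p (ccMr cf.1 cg)).
  congr integral_Rn; apply/funext => x.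
  have [x0|x0] := ltP 0 (x 0 ord0); last first.
    have hx : M < `|x| \/ x 0 ord0 < eps by right; exact: le_lt_trans e0.
    have [_ _ hu] := au.
    by rewrite (hsupp_grad_norm hu hx) /g (hsupp_grad_norm hw hx) !mulr0.
  rewrite /f /g (_ : N / (N - 2) = p - 1); last by rewrite pE; field; rewrite gt_eqF.
  rewrite /u (grad_norm_powR p2 cw x0).
  have h1 : N / (2 * (N - 1)) + (N - 2) / (2 * (N - 1)) = 1 by field; rewrite gt_eqF.
  rewrite [in LHS](powR_split (Pw_gt0 k sigma x) h1).
  move: (powR _ _) (powR _ _) (powR _ _) (grad_norm _ _) => a b c d.
  by ring.
have := hC u M eps au; rewrite gradu.
have -> : integral_Rn (fun x => powR (Pw k sigma x * `|u x|) (gns_exp m.+1)) = A.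
  by congr integral_Rn; apply/funext => x; rewrite PhiU.
rewrite rE invf_div => CA.
apply: (absorb_powR N3 C0 p0 A0 B0); apply: le_trans CA _.
by rewrite (ler_pM2l p0); exact: fg.
Qed.
End weighted_sobolev.
(** A compact subset of the open half-space is bounded, and x_1 attains on it a minimum, which is
    positive; the empty set is treated apart because it has no minimum. *)
Lemma Cc_infty_half_admissible {R : realType} {n : nat} (w : 'rV[R]_n.+1 -> R) :
  Cc_infty_half w -> exists M eps, admissible M eps w.
Proof.
move=> [sw [K [cK [KH hK]]]].
have [M hM] : exists M : R, forall x : 'rV[R]_n.+1, K x -> `|x| <= M.
  have [M [_ hM]] := compact_bounded cK.
  by exists (M + 1) => x Kx; apply: hM => //; rewrite ltrDl.
have [eps e0 he] : exists2 eps : R, 0 < eps & forall x : 'rV[R]_n.+1, K x -> eps <= x 0 ord0.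
  have [K0|/set0P K0] := eqVneq K set0; first by exists 1 => // x; rewrite K0.
  have cf : {within K, continuous (fun x : 'rV[R]_n.+1 => x 0 ord0)}.
    by apply: continuous_subspaceT => x; exact: coord_continuous.
  have [c cK' hc] := compact_EVT_min K0 cK cf.
  exists (c 0 ord0); first by apply: KH; exact: set_mem.
  by move=> x Kx; apply: hc; exact: mem_set.
exists M, eps; split; first exact: e0.
  split.
  - by move=> x _; exact: (sw [::]).1.
  - by move=> i x _; exact: (sw [::]).2.
  - by move=> i x _; exact: (sw [:: i]).1.
move=> x hx; apply: hK => Kx; case: hx => hx.
  by move: (hM _ Kx); rewrite leNgt hx.
by move: (he _ Kx); rewrite leNgt hx.
Qed.

(** This trades [weight] for [Pw], which agree only where x_1 > 0; elsewhere the factor coming from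
    [w] makes the new integrand 0. *)
Lemma integral_halfE {R : realType} {n : nat} (f g : 'rV[R]_n.+1 -> R) :
  (forall x : 'rV[R]_n.+1, 0 < x 0 ord0 -> f x = g x) ->
  (forall x : 'rV[R]_n.+1, x 0 ord0 <= 0 -> g x = 0) ->
  integral_half f = integral_Rn g.
Proof.
move=> fg g0; congr integral_Rn; apply/funext => x.
by case: ltP => [/fg|/g0].
Qed.

Theorem theorem3p1 (R : realType) (n k : nat) (sigma : nat -> R)
  (hn : (3 <= n)%N) (hk1 : (1 <= k)%N) (hkn : (k <= n)%N)
  (hc : forall l : nat, (1 <= l <= k)%N -> sigma l != 0 -> cconst sigma l != 0) :
  exists C : R, 0 < C /\
  forall w : 'rV[R]_n.-1.+1 -> R, Cc_infty_half w ->
    integral_half (fun x => weight k sigma x * grad_norm w x)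
      >= C * powR (integral_half (fun x =>
               powR (weight k sigma x * `|w x|) (n%:R / (n%:R - 1))))
             ((n%:R - 1) / n%:R)
    /\
    integral_half (fun x =>
        weight k (fun j => sigma j * (n%:R - 2) / (n%:R - 1)) x * grad_norm w x ^+ 2)
      >= C * powR (integral_half (fun x =>
               powR (weight k (fun j => sigma j * (n%:R - 2) / (2 * (n%:R - 1))) x * `|w x|)
                    (2 * n%:R / (n%:R - 2))))
             ((n%:R - 2) / n%:R).
Proof.
case: n hn hkn => [//|[//|[//|m]]] _ hkn; change m.+3.-1 with m.+2.
(* The L^1 statement lives in dimension m+2 and the L^2 one in dimension m+3, hence the shift by
   one. *)
have [C1 C10 H1] := weighted_sobolev_L1 (m := m.+1) hkn hc.
have [C2 C20 H2] := weighted_sobolev_L2 hkn hc.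
exists (Num.min C1 C2); split; first by rewrite lt_min C10.
move=> w hw; have [M [eps aw]] := Cc_infty_half_admissible hw.
have [e0 cw hsw] := aw.
have N2 : 0 < m.+2%:R :> R by rewrite ltr0Sn.
have N3 : 0 < m.+3%:R :> R by rewrite ltr0Sn.
have N1E : m.+3%:R - 1 = m.+2%:R :> R by rewrite -natr1 addrK.
have rE : gns_exp m.+1 = m.+3%:R / (m.+3%:R - 1) :> R.
  by rewrite N1E /gns_exp -[m.+3%:R]natr1; field; rewrite gt_eqF.
have off (x : 'rV[R]_m.+3) : x 0 ord0 <= 0 -> M < `|x| \/ x 0 ord0 < eps.
  by move=> x0; right; exact: le_lt_trans e0.
have w0 (x : 'rV[R]_m.+3) : x 0 ord0 <= 0 -> w x = 0 by move=> /off; exact: hsw.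
have gw0 (x : 'rV[R]_m.+3) : x 0 ord0 <= 0 -> grad_norm w x = 0 by move=> /off; exact: (hsupp_grad_norm hsw).
have s0 : m.+3%:R - 2 != 0 :> R.
  by rewrite gt_eqF// subr_gt0 ltr_nat.
have expE (a b : R) : (fun j => sigma j * a / b) = (fun j => sigma j * (a / b)).
  by apply/funext => j; rewrite mulrA.
split.
  have -> : integral_half (fun x => weight k sigma x * grad_norm w x) =
      integral_Rn (fun x => Pw k sigma x * grad_norm w x).
    apply: integral_halfE => x x0; first by rewrite weightE.
    by rewrite gw0// mulr0.
  have -> : integral_half (fun x => powR (weight k sigma x * `|w x|) (m.+3%:R / (m.+3%:R - 1))) =
      integral_Rn (fun x => powR (Pw k sigma x * `|w x|) (gns_exp m.+1)).
    apply: integral_halfE => x x0; first by rewrite weightE// rE.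
    by rewrite w0// normr0 mulr0 powR0// gt_eqF// gns_exp_gt0.
  rewrite (_ : (m.+3%:R - 1) / m.+3%:R = (gns_exp m.+1)^-1); last by rewrite rE invf_div.
  apply: le_trans (H1 w M eps aw); apply: ler_wpM2r; first exact: powR_ge0.
  by rewrite ge_min lexx.
have -> : integral_half (fun x =>
    weight k (fun j => sigma j * (m.+3%:R - 2) / (m.+3%:R - 1)) x * grad_norm w x ^+ 2) =
  integral_Rn (fun x =>
    Pw k (fun j => sigma j * ((m.+3%:R - 2) / (m.+3%:R - 1))) x * grad_norm w x ^+ 2).
  apply: integral_halfE => x x0; last by rewrite gw0// expr0n mulr0.
  by rewrite expE (weightE _ _ x0).
have -> : integral_half (fun x =>
    powR (weight k (fun j => sigma j * (m.+3%:R - 2) / (2 * (m.+3%:R - 1))) x * `|w x|)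
      (2 * m.+3%:R / (m.+3%:R - 2))) =
  integral_Rn (fun x =>
    powR (Pw k (fun j => sigma j * ((m.+3%:R - 2) / (2 * (m.+3%:R - 1)))) x * `|w x|)
      (2 * m.+3%:R / (m.+3%:R - 2))).
  apply: integral_halfE => x x0.
    by rewrite expE (weightE _ _ x0).
  (* A nonzero exponent is essential, as [powR 0 0] is 1. *)
  by rewrite w0// normr0 mulr0 powR0// mulf_neq0 ?invr_neq0//.
apply: le_trans (H2 w M eps aw); apply: ler_wpM2r; first exact: powR_ge0.
by rewrite ge_min lexx orbT.
Qed.
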